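(* Let $F$ be a graph with chromatic number $\chi(F)=k+1$, where $k\ge r\ge 2$. Then \[ \mathrm{ex}^{lin}_q(n,F^r)=\frac{2n}{r-1}\left(1-\frac1k\right)+o(n)\quad (n\to\infty). \]
   Context: An $r$-uniform hypergraph is linear if any two distinct edges share at most one vertex; $d_H(v)$ is the number of edges containing $v$. Its signless Laplacian spectral radius is $q(H)=\max_{\|\mathbf{x}\|_r=1}\big(\sum_{v}d_H(v)x_v^r + r\sum_{e\in E(H)}\prod_{v\in e}x_v\big)$ with $\|\mathbf{x}\|_r=(\sum_v|x_v|^r)^{1/r}$. For a graph $F$, the $r$-expansion $F^r$ is the $r$-uniform hypergraph obtained from $F$ by enlarging each edge with $r-2$ new vertices, disjoint from $V(F)$, distinct edges getting distinct new vertices. $\mathrm{ex}^{lin}_q(n,F^r)$ is the maximum of $q(H)$ over all linear $r$-uniform hypergraphs $H$ on $n$ vertices containing no sub-hypergraph isomorphic to $F^r$. *)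

(* Defs.v *)
From mathcomp Require Import all_boot all_order all_algebra.
From mathcomp Require Import reals.
Set Implicit Arguments. Unset Strict Implicit. Unset Printing Implicit Defensive.
Import Order.TTheory GRing.Theory Num.Theory.
Local Open Scope ring_scope.

Section Defs.
Variables (V : finType) (adj : rel V).

Definition simple_graph : Prop := symmetric adj /\ irreflexive adj.

Definition colorable (c : nat) : bool :=
  [exists f : {ffun V -> 'I_c}, [forall u, forall v, adj u v ==> (f u != f v)]].

Lemma colorable_card (Hirr : irreflexive adj) : colorable #|V|.
Proof.
apply/existsP; exists [ffun v => enum_rank v]; apply/forallP => u; apply/forallP => v.
apply/implyP => Huv; rewrite !ffunE; apply/negP => /eqP /enum_rank_inj Eq.
by move: Huv; rewrite Eq Hirr.
Qed.

Definition chromatic_number (Hirr : irreflexive adj) : nat :=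
  ex_minn (ex_intro (fun c => colorable c) _ (colorable_card Hirr)).

Definition graph_edges : {set {set V}} :=
  [set e : {set V} | [exists u, exists v, (e == [set u; v]) && adj u v]].

(* r-expansion F^r: vertex set V + (edge, new index), each edge e enlarged by
   the r-2 fresh vertices (e, i), i < r-2. *)
Definition exp_vertex (r : nat) := (V + ({set V} * 'I_(r - 2)))%type.

Definition expansion (r : nat) : {set {set exp_vertex r}} :=
  [set ((@inl V ({set V} * 'I_(r - 2))) @: e)
        :|: [set (@inr V ({set V} * 'I_(r - 2)) (e, i)) | i : 'I_(r - 2)]
   | e : {set V} in graph_edges].
End Defs.

Section Hyper.
Variable (n : nat).
Definition uniform (r : nat) (H : {set {set 'I_n}}) : bool :=
  [forall e in H, #|e| == r].

Definition linear (H : {set {set 'I_n}}) : bool :=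
  [forall e1 in H, forall e2 in H, (e1 != e2) ==> (#|e1 :&: e2| <= 1)%N].

Definition degree (H : {set {set 'I_n}}) (v : 'I_n) : nat :=
  #|[set e in H | v \in e]|.

Definition contains_copy (W : finType) (G : {set {set W}}) (H : {set {set 'I_n}}) : Prop :=
  exists f : W -> 'I_n, injective f /\ forall E, E \in G -> f @: E \in H.

Definition q_spec (R : realType) (r : nat) (H : {set {set 'I_n}}) : R :=
  sup (fun y : R => exists x : 'I_n -> R,
         \sum_(v < n) `|x v| ^+ r = 1 /\
         y = \sum_(v < n) (degree H v)%:R * x v ^+ r
             + r%:R * \sum_(e in H) \prod_(v in e) x v).

Definition ex_lin_q (R : realType) (V : finType) (adj : rel V) (r : nat) : R :=
  sup (fun y : R => exists H : {set {set 'I_n}},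
         [/\ uniform r H, linear H,
             ~ contains_copy (expansion adj r) H & y = q_spec R r H]).
End Hyper.

(* Main.v *)
(** Upper bound. By the arithmetic-geometric mean inequality over the pairs inside
    each hyperedge, the form defining [q H] is at most [1 / (r - 1)] times the
    signless Laplacian form of the shadow graph evaluated at [|x|^(r/2)]. If that
    exceeds [2 (1 - 1/k) n + eps n], truncating the large entries of the vector
    keeps the surplus, so a random sample of boundedly many vertices has a surplus
    too, and a weighted Turan inequality (proved by cloning a vertex of maximal
    contribution) puts a [K_(k+1)] in the sample. Hence the shadow has a positive
    density of [K_(k+1)], by Jensen's inequality a positive density of copies of
    [F], and all but [O(1/n)] of these extend to a copy of [F^r].

    Lower bound. A hypergraph whose edges are transversal to [k] classes contains
    no [F^r]. Take the points [(i, x, y)] with [i < k], [x] in a fixed large finite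
    field and [y] modulo [M], and the blocks
    [{(i, a + b * c_S(i), alpha + i * beta) : i in S}], where [|S| = r], [b] runs over
    the subgroup of index [D = 'C(k - 2, r - 2)] and, for fixed [i < j], the
    differences [c_S(j) - c_S(i)] lie in distinct cosets of that subgroup for the
    [D] sets [S] containing [i] and [j]. Such [c_S] exist by Wilson's cyclotomic
    argument. These blocks cover almost every transversal pair exactly once, and a
    constant vector gives the bound. *)

Require Import Defs.
From mathcomp Require Import all_boot all_order all_algebra all_solvable all_field.
From mathcomp Require Import reals.
From mathcomp Require Import ring lra zify.
Set Implicit Arguments. Unset Strict Implicit. Unset Printing Implicit Defensive.
Import Order.TTheory GRing.Theory Num.Theory.
Local Open Scope ring_scope.

(** * Averages over finite types *)

Section Averages.
Variable R : realFieldType.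

Definition avg (A : finType) (f : A -> R) : R := (\sum_a f a) / #|A|%:R.

Lemma eq_avg (A : finType) (f g : A -> R) : f =1 g -> avg f = avg g.
Proof. by move=> fg; congr (_ / _); apply: eq_bigr. Qed.

Lemma ler_avg (A : finType) (f g : A -> R) :
  (forall a, f a <= g a) -> avg f <= avg g.
Proof. by move=> fg; apply: ler_wpM2r; [rewrite invr_ge0 | apply: ler_sum]. Qed.

Lemma avg_ge0 (A : finType) (f : A -> R) : (forall a, 0 <= f a) -> 0 <= avg f.
Proof. by move=> f0; rewrite divr_ge0 ?sumr_ge0. Qed.

Lemma avg_cst (A : finType) (x : R) : (0 < #|A|)%N -> avg (fun _ : A => x) = x.
Proof.
move=> A0; rewrite /avg sumr_const -[X in X / _]mulr_natr mulfK //.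
by rewrite pnatr_eq0 -lt0n.
Qed.

Lemma avgD (A : finType) (f g : A -> R) :
  avg (fun a => f a + g a) = avg f + avg g.
Proof. by rewrite /avg big_split mulrDl. Qed.

Lemma avgZ (A : finType) (x : R) (f : A -> R) :
  avg (fun a => x * f a) = x * avg f.
Proof. by rewrite /avg -mulr_sumr mulrA. Qed.

Lemma avg_sum (A I : finType) (P : pred I) (f : I -> A -> R) :
  avg (fun a => \sum_(i | P i) f i a) = \sum_(i | P i) avg (f i).
Proof. by rewrite /avg exchange_big mulr_suml. Qed.

Lemma avg_exchange (A B : finType) (f : A -> B -> R) :
  avg (fun a => avg (f a)) = avg (fun b => avg (f^~ b)).
Proof.
rewrite /avg -!mulr_suml exchange_big.
by rewrite -!mulrA [X in _ * X]mulrC.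
Qed.

(** Convexity of powers: multiplying the case [t] by [a] gives the case [t.+1] with the slack
    [t.+1%:R * m ^+ t * (a - m) ^+ 2]. *)
Lemma tangent_exp (a m : R) t : 0 <= a -> 0 <= m ->
  m ^+ t.+1 + t.+1%:R * m ^+ t * (a - m) <= a ^+ t.+1.
Proof.
move=> a0 m0; elim: t => [|t IH]; first by rewrite !expr1 expr0; lra.
have := ler_wpM2l a0 IH; rewrite -exprS => {IH}; apply: le_trans.
rewrite -subr_ge0.
have -> : a * (m ^+ t.+1 + t.+1%:R * m ^+ t * (a - m)) -
   (m ^+ t.+2 + t.+2%:R * m ^+ t.+1 * (a - m)) =
   t.+1%:R * m ^+ t * (a - m) ^+ 2.
  by rewrite !exprS -[t.+2]addn1 natrD; ring.
by rewrite mulr_ge0 ?sqr_ge0 // mulr_ge0 ?ler0n ?exprn_ge0.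
Qed.

(** Jensen's inequality: the tangent taken at the mean is averaged, and its linear term vanishes. *)
Lemma avg_exp (A : finType) (f : A -> R) t : (0 < #|A|)%N ->
  (forall a, 0 <= f a) -> avg f ^+ t <= avg (fun a => f a ^+ t).
Proof.
move=> A0 f0; case: t => [|t]; first by rewrite expr0 avg_cst.
have m0 := @avg_ge0 A f f0; set m := avg f in m0 *.
have : avg (fun a => m ^+ t.+1 + t.+1%:R * m ^+ t * (f a - m))
       <= avg (fun a => f a ^+ t.+1).
  by apply: ler_avg => a; apply: tangent_exp.
by rewrite avgD avgZ avgD !avg_cst // -/m subrr mulr0 addr0.
Qed.

(* The map (g, s) |-> (put g s, get g) is an involution of G * S. *)
Lemma avg_lens (G S : finType) (get : G -> S) (put : G -> S -> G)
    (f : G -> S -> R) : (0 < #|G|)%N -> (0 < #|S|)%N ->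
  (forall g s, get (put g s) = s) -> (forall g s, put (put g s) (get g) = g) ->
  (forall g s s', f (put g s) s' = f g s') ->
  avg (fun g => f g (get g)) = avg (fun g => avg (f g)).
Proof.
move=> G0 S0 getK putK fput.
have -> : avg (fun g => f g (get g)) = avg (fun g => avg (fun _ : S => f g (get g))).
  by apply: eq_avg => g; rewrite avg_cst.
rewrite /avg -!mulr_suml; congr (_ / _ / _).
rewrite !pair_big /=.
pose sw (p : G * S) := (put p.1 p.2, get p.1).
have swK : involutive sw by case=> g s; rewrite /sw /= putK getK.
rewrite (reindex_inj (inv_inj swK)) /=.
by apply: eq_bigr => -[g s] _ /=; rewrite getK fput.
Qed.

Lemma avg_marginal (G S : finType) (get : G -> S) (put : G -> S -> G)
    (f : S -> R) : (0 < #|G|)%N -> (0 < #|S|)%N ->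
  (forall g s, get (put g s) = s) -> (forall g s, put (put g s) (get g) = g) ->
  avg (fun g => f (get g)) = avg f.
Proof.
move=> G0 S0 getK putK.
by rewrite (@avg_lens G S get put (fun _ => f)) // avg_cst.
Qed.

Lemma card_ffun_gt0 (A B : finType) : (0 < #|B|)%N -> (0 < #|{ffun A -> B}|)%N.
Proof. by move=> B0; rewrite card_ffun expn_gt0 B0. Qed.

(** A uniform random map stays uniform when restricted along an injection; [put] overwrites its
    values on the image of [i]. *)
Lemma avg_precomp (A B T : finType) (i : A -> B) (f : {ffun A -> T} -> R) :
  (0 < #|T|)%N -> injective i ->
  avg (fun s : {ffun B -> T} => f [ffun a => s (i a)]) = avg f.
Proof.
move=> T0 inj_i.
pose put (s : {ffun B -> T}) (x : {ffun A -> T}) : {ffun B -> T} :=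
  [ffun b => if [pick a | i a == b] is Some a then x a else s b].
have pick_i a : [pick a' | i a' == i a] = Some a.
  by case: pickP => [a' /eqP/inj_i->//|/(_ a)]; rewrite eqxx.
have marg := @avg_marginal _ {ffun A -> T}
  (fun s : {ffun B -> T} => [ffun a => s (i a)]) put f.
apply: marg; rewrite ?card_ffun_gt0 // => s x; apply/ffunP => j; rewrite !ffunE ?pick_i //.
by case: pickP => [a /eqP <-|]; rewrite ?ffunE.
Qed.

End Averages.

(** * Weighted Turan inequality *)

Section WeightedTuran.
Variable R : realFieldType.

Definition clique (T : finType) (adj : rel T) (k : nat) (s : 'I_k -> T) :=
  [forall i, forall j, (i != j) ==> adj (s i) (s j)].

Lemma cliqueP (T : finType) (adj : rel T) k (s : 'I_k -> T) :
  reflect (forall i j, i != j -> adj (s i) (s j)) (clique adj s).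
Proof.
by apply: (iffP forallP) => [h i j|h i]; [move/forallP/(_ j)/implyP: (h i)
  | apply/forallP => j; apply/implyP/h].
Qed.

(* An Erdős-type degree majorization: among the vertices of [A], the one
   maximizing its contribution is cloned onto all its non-neighbours. The
   unary term [h] absorbs the interaction with the classes already built. *)
Lemma multipartite_majorant (T : finType) (adj : rel T) (Y : T -> R) :
    symmetric adj -> irreflexive adj ->
  forall k (h : R -> R) (A : {set T}),
    (forall s : 'I_k.+1 -> T, (forall i, s i \in A) -> ~~ clique adj s) ->
  exists (p y : 'I_k -> R), [/\ forall i, 0 <= p i, \sum_i p i = #|A|%:R &
    \sum_(u in A) \sum_(v in A | adj u v) (Y u + Y v) ^+ 2 + \sum_(u in A) h (Y u)
    <= \sum_i \sum_j p i * p j * (y i + y j) ^+ 2 - 4 * \sum_i (p i * y i) ^+ 2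
       + \sum_i p i * h (y i)].
Proof.
move=> sym irr; elim=> [|k IH] h A noK; have [A0|[v0 v0A]] := set_0Vmem A.
- exists (fun=> 0), (fun=> 0); rewrite A0 cards0 !big_set0 !big_ord0.
  by split; rewrite // mulr0 subr0.
- case/negP: (noK (fun=> v0) (fun=> v0A)).
  by apply/cliqueP => i j; rewrite !ord1.
- exists (fun=> 0), (fun=> 0); split=> //; first by rewrite A0 cards0 big1.
  have z0 (f : 'I_k.+1 -> R) : \sum_i 0 * f i = 0.
    by rewrite big1 // => i _; rewrite mul0r.
  rewrite A0 !big_set0 z0 [X in 4 * X]big1 => [|i _]; last first.
    by rewrite mul0r expr0n.
  by rewrite big1 ?mulr0 ?subr0 // => i _; rewrite big1 // => j _; rewrite !mul0r.
(* The contribution of [w] to the left side; the factor 2 is there because an adjacent pair is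
   summed in both orders. *)
pose g w := 2 * (\sum_(z in A | adj w z) (Y w + Y z) ^+ 2) + h (Y w).
have [v vA vmax] : exists2 v, v \in A & forall w, w \in A -> g w <= g v.
  by case: (arg_maxP g v0A) => v vA vm; exists v.
pose A' := [set z in A | adj v z]; pose B := A :\: A'.
(* A clique inside the neighbourhood [A'] would extend by [v]. *)
have noK' (s : 'I_k.+1 -> T) : (forall i, s i \in A') -> ~~ clique adj s.
  move=> sA'; apply/negP => /cliqueP cs.
  pose s' (i : 'I_k.+2) := if unlift ord0 i is Some j then s j else v.
  have s'A i : s' i \in A.
    rewrite /s'; case: unliftP => [j _|_] //.
    by have := sA' j; rewrite inE => /andP[].
  case/negP: (noK s' s'A); apply/cliqueP => i j; rewrite /s'.
  case: unliftP => [i' ->|->]; case: unliftP => [j' ->|->]; rewrite ?eqxx //.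
  - by rewrite (inj_eq lift_inj) => /cs.
  - by move=> _; rewrite sym; have := sA' i'; rewrite inE => /andP[].
  - by move=> _; have := sA' j'; rewrite inE => /andP[].
pose b : R := #|B|%:R; pose y0 := Y v.
(* The non-neighbours [B] of [v] form one more class, of weight [b] and value [y0]; its interaction
   with [A'], in both orders, is moved into the unary term. *)
have [p [y [p0 psum ple]]] := IH (fun t => h t + 2 * b * (y0 + t) ^+ 2) A' noK'.
pose q (i : 'I_k.+1) := if unlift ord0 i is Some j then p j else b.
pose z (i : 'I_k.+1) := if unlift ord0 i is Some j then y j else y0.
have ql i : q (lift ord0 i) = p i by rewrite /q liftK.
have zl i : z (lift ord0 i) = y i by rewrite /z liftK.
have q0 : q ord0 = b by rewrite /q unlift_none.
have z0 : z ord0 = y0 by rewrite /z unlift_none.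
have sA'A : A' \subset A by apply/subsetP => w; rewrite inE => /andP[].
exists q, z; split.
- by move=> i; rewrite /q; case: unlift => [j|]; rewrite ?p0 ?ler0n.
- rewrite big_ord_recl q0 (eq_bigr p) => [|i _]; last by rewrite ql.
  rewrite psum -natrD; congr (_%:R).
  by rewrite (cardsD A A') (setIidPr sA'A) subnK ?subset_leq_card.
have splitA (f : T -> R) :
    \sum_(u in A) f u = \sum_(u in A') f u + \sum_(u in B) f u.
  by rewrite (big_setID A') /= (setIidPr sA'A).
have splitA2 w (f : T -> R) : \sum_(u in A | adj w u) f u =
    \sum_(u in A' | adj w u) f u + \sum_(u in B | adj w u) f u.
  by rewrite (big_setIDcond _ _ A') /= (setIidPr sA'A).
(* Summing [g] over [B] counts the pairs inside [B] twice instead of once; this excess is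
   nonnegative. *)
have maj : \sum_(u in A) \sum_(w in A | adj u w) (Y u + Y w) ^+ 2
           + \sum_(u in A) h (Y u) <=
  \sum_(u in A') \sum_(w in A' | adj u w) (Y u + Y w) ^+ 2
           + \sum_(u in A') h (Y u) + \sum_(u in B) g u.
  rewrite 2!splitA /g big_split /= -mulr_sumr.
  have -> : \sum_(u in A') \sum_(w in A | adj u w) (Y u + Y w) ^+ 2 =
    \sum_(u in A') \sum_(w in A' | adj u w) (Y u + Y w) ^+ 2 +
    \sum_(u in B) \sum_(w in A' | adj u w) (Y u + Y w) ^+ 2.
    under eq_bigr => u _ do rewrite splitA2.
    rewrite big_split /=; congr (_ + _).
    rewrite (exchange_big_dep (mem B)) //=; last by move=> i j _ /andP[].
    apply: eq_bigr => u uB; apply: eq_big => [w|w _]; last by rewrite addrC.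
    by rewrite uB /= sym.
  set S1 := \sum_(u in A') \sum_(w in A' | _) _.
  set S2 := \sum_(u in B) \sum_(w in A' | _) _.
  have -> : \sum_(u in B) \sum_(w in A | adj u w) (Y u + Y w) ^+ 2 =
     S2 + \sum_(u in B) \sum_(w in B | adj u w) (Y u + Y w) ^+ 2.
    by rewrite -big_split; apply: eq_bigr => u _; rewrite splitA2.
  have : 0 <= \sum_(u in B) \sum_(w in B | adj u w) (Y u + Y w) ^+ 2.
    by do 2 (apply: sumr_ge0 => ? _); rewrite sqr_ge0.
  lra.
apply: (le_trans maj).
have gB : \sum_(u in B) g u <= b * g v.
  rewrite /b mulrC mulr_natr -sumr_const; apply: ler_sum => u.
  by rewrite inE => /andP[_ /vmax].
have gv : b * g v = \sum_(u in A') 2 * b * (y0 + Y u) ^+ 2 + b * h y0.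
  rewrite /g mulrDr; congr (_ + _); rewrite mulrA [b * 2]mulrC -mulr_sumr.
  by congr (_ * _); apply: eq_bigl => u; rewrite inE.
rewrite {}gv in gB.
have goalE : \sum_i \sum_j q i * q j * (z i + z j) ^+ 2
     - 4 * \sum_i (q i * z i) ^+ 2 + \sum_i q i * h (z i) =
  \sum_i \sum_j p i * p j * (y i + y j) ^+ 2 - 4 * \sum_i (p i * y i) ^+ 2
   + \sum_i p i * (h (y i) + 2 * b * (y0 + y i) ^+ 2) + b * h y0.
  have recl (f : R -> R -> R) :
      \sum_i f (q i) (z i) = f b y0 + \sum_i f (p i) (y i).
    rewrite big_ord_recl q0 z0; congr (_ + _).
    by apply: eq_bigr => i _; rewrite ql zl.
  rewrite (recl (fun s t => s * h t)) (recl (fun s t => (s * t) ^+ 2)).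
  rewrite (recl (fun s t => \sum_j s * q j * (t + z j) ^+ 2)).
  rewrite (recl (fun s t => b * s * (y0 + t) ^+ 2)).
  under [X in _ + X - _ + _]eq_bigr => i _.
    rewrite (recl (fun s t => p i * s * (y i + t) ^+ 2)); over.
  rewrite big_split /=.
  under [X in _ = _ + X + _]eq_bigr => i _ do rewrite mulrDr.
  rewrite [in RHS]big_split /=.
  have -> : \sum_i p i * b * (y i + y0) ^+ 2 = \sum_i b * p i * (y0 + y i) ^+ 2.
    by apply: eq_bigr => i _; ring.
  have -> : \sum_i p i * (2 * b * (y0 + y i) ^+ 2) =
            2 * \sum_i b * p i * (y0 + y i) ^+ 2.
    by rewrite mulr_sumr; apply: eq_bigr => i _; ring.
  ring.
rewrite goalE; move: ple; rewrite [X in _ + X <= _ -> _]big_split /=; lra.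
Qed.

(** The left side is the form of a complete multipartite graph with class weights [p i] and one
    value [y i] per class. After expansion the claim reads [S ^+ 2 <= m * (1 - 2 * ki) * Q + 2 *
    \sum_i (p i * y i) ^+ 2]. *)
Lemma multipartite_bound k (p y : 'I_k -> R) (m : R) : (2 <= k)%N -> 0 < m ->
  (forall i, 0 <= p i) -> \sum_i p i = m ->
  \sum_i \sum_j p i * p j * (y i + y j) ^+ 2 - 4 * \sum_i (p i * y i) ^+ 2
  <= 4 * (1 - k%:R^-1) * m * \sum_i p i * y i ^+ 2.
Proof.
move=> k2 m0 p0 psum.
pose S := \sum_i p i * y i; pose Q := \sum_i p i * y i ^+ 2.
have k0 : (0 : R) < k%:R by rewrite ltr0n; apply: leq_trans k2.
have -> : \sum_i \sum_j p i * p j * (y i + y j) ^+ 2 = 2 * m * Q + 2 * S ^+ 2.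
  under eq_bigr => i _.
    have -> : \sum_j p i * p j * (y i + y j) ^+ 2 =
              p i * y i ^+ 2 * m + 2 * (p i * y i) * S + p i * Q.
      rewrite -psum /S /Q !mulr_sumr -!big_split /=; apply: eq_bigr => j _; ring.
    over.
  by rewrite !big_split /= -!mulr_suml -mulr_sumr psum -/S -/Q; ring.
pose ki : R := k%:R^-1.
have kki : k%:R * ki = 1 by rewrite mulfV // gt_eqF.
have ki0 : 0 < ki by rewrite invr_gt0.
have ki2 : ki <= 2^-1.
  by rewrite lef_pV2 ?posrE // (ler_nat _ 2 k).
pose c i := m * (1 - 2 * ki) + 2 * p i.
pose tau i := ki + (1 - 2 * ki) * (p i / m - ki).
(* [tau i] is the tangent at [p i = m / k] of the concave function
   [p i / c i]; the [tau i] sum to 1, and Cauchy-Schwarz follows. *)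
have tau1 : \sum_i tau i = 1.
  rewrite big_split /= -mulr_sumr sumrB -mulr_suml psum divff ?gt_eqF //.
  by rewrite !sumr_const card_ord -[ki *+ k]mulr_natl kki; ring.
have cs i : 0 <= p i * y i ^+ 2 * c i - 2 * (p i * y i) * S + S ^+ 2 * tau i.
  pose w := p i / m.
  have pw : p i = w * m by rewrite /w divfK // gt_eqF.
  have w0 : 0 <= w by rewrite divr_ge0 // ltW.
  have tw : tau i = ki + (1 - 2 * ki) * (w - ki) by [].
  have cw : c i = m * (1 - 2 * ki + 2 * w) by rewrite /c pw; ring.
  rewrite tw cw pw.
  have c0 : 0 <= 1 - 2 * ki + 2 * w by lra.
  have t0 : 0 <= ki + (1 - 2 * ki) * (w - ki) by nra.
  (* The discriminant condition [p i <= c i * tau i], divided by [m]. *)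
  have dt : w <= (ki + (1 - 2 * ki) * (w - ki)) * (1 - 2 * ki + 2 * w).
    rewrite -subr_ge0.
    have -> : (ki + (1 - 2 * ki) * (w - ki)) * (1 - 2 * ki + 2 * w) - w =
       2 * (1 - 2 * ki) * (w - ki) ^+ 2 by ring.
    by rewrite mulr_ge0 ?sqr_ge0 //; lra.
  move: c0 t0 dt.
  set d := 1 - 2 * ki + 2 * w; set t := ki + _ => c0 t0 dt.
  have -> : w * m * y i ^+ 2 * (m * d) - 2 * (w * m * y i) * S + S ^+ 2 * t =
    w * d * (m * y i) ^+ 2 - 2 * w * (m * y i) * S + t * S ^+ 2 by ring.
  set x := m * y i.
  have [t_eq0|t_neq0] := eqVneq t 0.
    have w_eq0 : w = 0 by move: dt; rewrite t_eq0 mul0r; lra.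
    by rewrite w_eq0 t_eq0 !(mul0r, mulr0) subr0 addr0.
  have tp : 0 < t by rewrite lt_neqAle eq_sym t_neq0.
  rewrite -(pmulr_rge0 _ tp).
  have -> : t * (w * d * x ^+ 2 - 2 * w * x * S + t * S ^+ 2) =
    (t * S - w * x) ^+ 2 + w * x ^+ 2 * (t * d - w) by ring.
  apply: addr_ge0; first exact: sqr_ge0.
  by apply: mulr_ge0; [rewrite mulr_ge0 ?sqr_ge0 | rewrite subr_ge0].
have : 0 <= \sum_i (p i * y i ^+ 2 * c i - 2 * (p i * y i) * S + S ^+ 2 * tau i).
  by apply: sumr_ge0.
rewrite big_split sumrB /= -mulr_sumr tau1 -mulr_suml -mulr_sumr -/S.
have -> : \sum_i p i * y i ^+ 2 * c i = m * (1 - 2 * ki) * Q +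
    2 * \sum_i (p i * y i) ^+ 2.
  by rewrite /Q !mulr_sumr -big_split; apply: eq_bigr => i _; rewrite /c /=; ring.
rewrite -/Q -/ki; lra.
Qed.

Lemma weighted_turan (T : finType) (adj : rel T) (Y : T -> R) k :
    symmetric adj -> irreflexive adj -> (2 <= k)%N ->
    (forall s : 'I_k.+1 -> T, ~~ clique adj s) ->
  \sum_u \sum_(v | adj u v) (Y u + Y v) ^+ 2
    <= 4 * (1 - k%:R^-1) * #|T|%:R * \sum_u Y u ^+ 2.
Proof.
move=> sym irr k2 noK.
have [T0|] := posnP #|T|.
  by rewrite !big1 ?mulr0 // => u; have := fintype0 u T0.
rewrite -(ltr_nat R); set m : R := #|T|%:R => m0.
(* The unary term is minus the share of one vertex in the target, so it remains to see that the
   majorant is nonpositive. *)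
have [p [y [p0 psum]]] := @multipartite_majorant T adj Y sym irr k
  (fun t => - (4 * (1 - k%:R^-1) * m) * t ^+ 2) setT (fun s _ => noK s).
rewrite cardsT -/m in psum.
have := multipartite_bound y k2 m0 p0 psum.
have inT : (mem [set: T]) =1 xpredT by move=> u; rewrite /= inE.
rewrite !(eq_bigl _ _ inT).
under eq_bigr => u _.
  rewrite (eq_bigl (fun v => adj u v)); last by move=> v; rewrite inE.
  over.
rewrite -mulr_sumr.
have -> : \sum_i p i * (- (4 * (1 - k%:R^-1) * m) * y i ^+ 2) =
   - (4 * (1 - k%:R^-1) * m) * \sum_i p i * y i ^+ 2.
  by rewrite mulr_sumr; apply: eq_bigr => i _; ring.
lra.
Qed.

End WeightedTuran.

(** * Sampling and blow-up *)

Section Counting.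
Variable R : realFieldType.

Definition fcons (T : finType) j (x : T) (s : {ffun 'I_j -> T}) : {ffun 'I_j.+1 -> T} :=
  [ffun i => if unlift ord0 i is Some i' then s i' else x].

Lemma fcons0 (T : finType) j (x : T) (s : {ffun 'I_j -> T}) : fcons x s ord0 = x.
Proof. by rewrite ffunE unlift_none. Qed.

Lemma fconsS (T : finType) j (x : T) (s : {ffun 'I_j -> T}) i :
  fcons x s (lift ord0 i) = s i.
Proof. by rewrite ffunE liftK. Qed.

Lemma avg_fcons (T : finType) j (f : {ffun 'I_j.+1 -> T} -> R) :
  avg f = avg (fun x => avg (fun s : {ffun 'I_j -> T} => f (fcons x s))).
Proof.
rewrite /avg -mulr_suml pair_big /= -mulrA -invfM -natrM; congr (_ / _%:R); last first.
  by rewrite !card_ffun !card_ord expnSr.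
pose unc (s : {ffun 'I_j.+1 -> T}) := (s ord0, [ffun i : 'I_j => s (lift ord0 i)]).
rewrite (reindex (fun p : T * {ffun 'I_j -> T} => fcons p.1 p.2)) //=.
exists unc => [[x s]|s] _; rewrite /unc /=.
  by rewrite fcons0; congr (_, _); apply/ffunP => i; rewrite ffunE fconsS.
apply/ffunP => i; rewrite ffunE; case: unliftP => [i' ->|->//].
by rewrite ffunE.
Qed.

Lemma avg_prod (U T : finType) (f : T -> R) :
  avg (fun h : {ffun U -> T} => \prod_u f (h u)) = avg f ^+ #|U|.
Proof.
rewrite /avg -(bigA_distr_bigA (fun _ : U => f)) /= prodr_const.
by rewrite expr_div_n card_ffun natrX.
Qed.

Lemma prod_indicator (U : finType) (P : pred U) :
  \prod_u (P u)%:R = [forall u, P u]%:R :> R.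
Proof.
case: forallP => [h|/forallP]; first by rewrite big1 // => u _; rewrite h.
by rewrite negb_forall => /existsP[u /negbTE Pu]; rewrite (bigD1 u) //= Pu mul0r.
Qed.

(* Erdős' blow-up: each of the [j] coordinates is replaced by [#|U|] independent
   copies, at the cost of one use of Jensen's inequality per coordinate. *)
Lemma blowup_density (T U : finType) j (P : pred {ffun 'I_j -> T}) : (0 < #|T|)%N ->
  avg (fun s => (P s)%:R : R) ^+ (#|U| ^ j) <=
  avg (fun g : {ffun 'I_j -> {ffun U -> T}} =>
    [forall si : {ffun 'I_j -> U}, P [ffun i => g i (si i)]]%:R).
Proof.
move=> T0; elim: j P => [|j IH] P.
  have un0 (A : finType) (s s' : {ffun 'I_0 -> A}) : s = s'.
    by apply/ffunP => -[].
  have /card_gt0P[s0 _] := card_ffun_gt0 'I_0 T0.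
  have W0 := card_ffun_gt0 U T0.
  rewrite expn0 expr1 (@eq_avg _ _ _ (fun=> (P s0)%:R)) => [|s]; last first.
    by rewrite (un0 _ s s0).
  rewrite avg_cst ?card_ffun_gt0 // -[leLHS](@avg_cst _ {ffun 'I_0 -> {ffun U -> T}}) //;
    last first.
    exact: card_ffun_gt0.
  apply: ler_avg => g; rewrite ler_nat.
  case Ps0: (P s0) => //; rewrite lt0b; apply/forallP => si.
  by rewrite (un0 _ [ffun i => g i (si i)] s0).
pose Ph (h : {ffun U -> T}) (x : {ffun 'I_j -> T}) := [forall u, P (fcons (h u) x)].
rewrite [leRHS]avg_fcons.
rewrite [leRHS](_ : _ = avg (fun h => avg (fun g : {ffun 'I_j -> {ffun U -> T}} =>
      [forall si : {ffun 'I_j -> U}, Ph h [ffun i => g i (si i)]]%:R))); last first.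
  apply: eq_avg => h; apply: eq_avg => g; congr (_%:R); congr nat_of_bool.
  have E (u : U) (si : {ffun 'I_j -> U}) :
      [ffun i => fcons h g i (fcons u si i)] = fcons (h u) [ffun i => g i (si i)].
    apply/ffunP => i; rewrite [LHS]ffunE.
    by case: (unliftP ord0 i) => [i' ->|->]; rewrite ?fconsS ?fcons0 // ffunE.
  apply/forallP/forallP => [H si|H si].
    by apply/forallP => u; rewrite -E.
  have -> : si = fcons (si ord0) [ffun i => si (lift ord0 i)].
    by apply/ffunP => i; case: (unliftP ord0 i) => [i' ->|->];
      rewrite ?fconsS ?fcons0 // ffunE.
  by rewrite E; have /forallP := H [ffun i => si (lift ord0 i)]; apply.
apply: le_trans (ler_avg (fun h => IH (Ph h))).
have avg_b0 (A : finType) (Q : pred A) : 0 <= avg (fun a => (Q a)%:R : R).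
  by apply: avg_ge0 => a; rewrite ler0n.
apply: le_trans (avg_exp _ _ _) => //; last exact: card_ffun_gt0.
rewrite expnS exprM.
(* For fixed [s] the [#|U|] copies of the first coordinate are independent, so the average over [h]
   is a power. *)
have -> : avg (fun h => avg (fun s => (Ph h s)%:R)) =
    avg (fun s => avg (fun x => (P (fcons x s))%:R) ^+ #|U|) :> R.
  rewrite avg_exchange; apply: eq_avg => s; rewrite -avg_prod.
  by apply: eq_avg => h; rewrite prod_indicator.
apply: lerXn2r; rewrite ?nnegrE ?exprn_ge0 //.
  by apply: avg_ge0 => s; rewrite exprn_ge0.
rewrite avg_fcons avg_exchange; apply: avg_exp; first exact: card_ffun_gt0.
by move=> s.
Qed.

(** A blow-up of the clique with parts indexed by [V] contains [F]: a vertex [v] goes to the copy of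
    index [v] in the part of its colour [c v]. *)
Lemma hom_density (T V : finType) (adjF : rel V) (adj : rel T) j (c : V -> 'I_j) :
  (0 < #|T|)%N -> (forall u v, adjF u v -> c u != c v) ->
  avg (fun s : {ffun 'I_j -> T} => (clique adj s)%:R : R) ^+ (#|V| ^ j) <=
  avg (fun s : {ffun V -> T} =>
    [forall u, forall v, adjF u v ==> adj (s u) (s v)]%:R).
Proof.
move=> T0 cP.
apply: le_trans (blowup_density V (fun s : {ffun 'I_j -> T} => clique adj s) T0) _.
pose get (g : {ffun 'I_j -> {ffun V -> T}}) := [ffun v => g (c v) v].
pose put (g : {ffun 'I_j -> {ffun V -> T}}) (s : {ffun V -> T}) :=
  [ffun i => [ffun v => if c v == i then s v else g i v]].
rewrite -(@avg_marginal _ _ _ get put); last first.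
- move=> g s; apply/ffunP => i; apply/ffunP => v; rewrite !ffunE.
  by case: eqP => // <-.
- by move=> g s; apply/ffunP => v; rewrite !ffunE eqxx.
- exact: card_ffun_gt0.
- by do 2! apply: card_ffun_gt0.
apply: ler_avg => g; rewrite ler_nat.
case: (@forallP {ffun 'I_j -> V}) => // H; rewrite (_ : [forall u, _] = true) //.
apply/forallP => u; apply/forallP => v.
apply/implyP => uv; rewrite !ffunE.
(* The choice of copies takes [u] in the part of [u] and [v] in all others, among them the part of
   [v]. *)
have /cliqueP/(_ (c u) (c v) (cP _ _ uv)) :=
  H [ffun i => if i == c u then u else v].
by rewrite !ffunE eqxx eq_sym (negbTE (cP _ _ uv)).
Qed.

Lemma avg_proj (I T : finType) (i : I) (f : T -> R) : (0 < #|T|)%N ->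
  avg (fun s : {ffun I -> T} => f (s i)) = avg f.
Proof.
move=> T0.
pose put (s : {ffun I -> T}) x := [ffun l => if l == i then x else s l].
apply: (@avg_marginal _ _ _ (fun s : {ffun I -> T} => s i) put) => //.
- exact: card_ffun_gt0.
- by move=> s x; rewrite ffunE eqxx.
- by move=> s x; apply/ffunP => l; rewrite !ffunE; case: eqP => // ->.
Qed.

Lemma avg_proj2 (I T : finType) (i j : I) (f : T -> T -> R) : (0 < #|T|)%N ->
  i != j -> avg (fun s : {ffun I -> T} => f (s i) (s j)) =
  avg (fun x => avg (f x)).
Proof.
move=> T0 ij.
pose put (s : {ffun I -> T}) (p : T * T) :=
  [ffun l => if l == i then p.1 else if l == j then p.2 else s l].
have := @avg_marginal R _ _ (fun s : {ffun I -> T} => (s i, s j)) put (fun p => f p.1 p.2).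
move=> /= ->.
- by rewrite /avg -mulr_suml pair_big /= card_prod natrM invfM mulrA.
- exact: card_ffun_gt0.
- by rewrite card_prod muln_gt0 T0.
- by move=> s [x y]; rewrite !ffunE eqxx eq_sym (negbTE ij) eqxx.
- move=> s [x y]; apply/ffunP => l; rewrite !ffunE /=.
  by case: eqP => [->|_] //; case: eqP => // ->.
Qed.

Lemma sqr_add_bound (x y K : R) : 0 <= x <= K -> 0 <= y <= K ->
  (x + y) ^+ 2 <= 4 * K ^+ 2.
Proof.
move=> /andP[x0 xK] /andP[y0 yK].
have -> : 4 * K ^+ 2 = (K + K) ^+ 2 by ring.
by rewrite ler_sqr ?nnegrE ?lerD ?addr_ge0 // (le_trans x0).
Qed.

(** Here [a] and [b] are means over pairs and over points. A sample of size [M] has only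
    [M * (M - 1)] off-diagonal pairs, and [eps * M] is large enough to pay for the missing
    diagonal. *)
Lemma sample_surplus (M cc eps a b : R) : 1 <= M -> 4 + 4 * eps <= eps * M ->
    0 < eps -> cc <= 4 -> 0 <= b -> b <= 1 ->
    (cc + 2 * eps) * b + 2 * eps <= a ->
  eps <= M * (M - 1) * a - cc * M * (M * b).
Proof.
move=> mr1 mbig e0 cc4 b0 b1 ab.
have mm : 0 <= M * (M - 1) by rewrite mulr_ge0; lra.
have := ler_wpM2l mm ab.
have : M * (cc * b) <= M * 4.
  by apply: ler_wpM2l; [lra | apply: le_trans (ler_wpM2r b0 cc4) _; lra].
have : M * (eps * b) <= M * eps.
  by apply: ler_wpM2l; [lra | apply: ler_piMr; [exact: ltW|]].
have : M * (4 + 4 * eps) <= M * (eps * M) by apply: ler_wpM2l; lra.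
have : eps * 1 <= eps * (M * M).
  apply: ler_wpM2l; first exact: ltW.
  by apply: mulr_ege1.
have : 0 <= eps * b * M ^+ 2.
  by apply: mulr_ge0; [apply: mulr_ge0; lra | exact: sqr_ge0].
lra.
Qed.

(** The surplus [F] of a random [m]-tuple has mean at least [eps]. It is nonpositive on a tuple
    without a clique, by [weighted_turan], and at most [4 * K ^+ 2 * m%:R ^+ 2] on any other, so
    cliques must be frequent. *)
Lemma clique_density (T : finType) (adj : rel T) (Y : T -> R) k m (eps K : R) :
    symmetric adj -> irreflexive adj -> (2 <= k)%N -> 0 < eps -> (0 < #|T|)%N ->
    (forall u, 0 <= Y u <= K) -> \sum_u Y u ^+ 2 <= #|T|%:R ->
    2 * (2 * (1 - k%:R^-1) + eps) * #|T|%:R * (\sum_u Y u ^+ 2)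
      + 2 * eps * #|T|%:R ^+ 2 <= \sum_u \sum_(v | adj u v) (Y u + Y v) ^+ 2 ->
    4 + 4 * eps <= eps * m%:R ->
  eps <= 4 * K ^+ 2 * m%:R ^+ 2 * m%:R ^+ k.+1 *
    avg (fun s : {ffun 'I_k.+1 -> T} => (clique adj s)%:R).
Proof.
move=> sym irr k2 e0 T0 YK Qn Sbig mbig.
set n : R := #|T|%:R in Qn Sbig; set cl := avg _.
have n0 : 0 < n by rewrite ltr0n.
set S := \sum_u _ in Sbig; set Q := \sum_u _ in Qn Sbig.
pose cc : R := 4 * (1 - k%:R^-1).
have cc4 : cc <= 4.
  have : (0 : R) <= k%:R^-1 by rewrite invr_ge0 ler0n.
  by rewrite /cc; lra.
pose F (s : {ffun 'I_m -> T}) :=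
  \sum_i \sum_(j | adj (s i) (s j)) (Y (s i) + Y (s j)) ^+ 2
   - cc * m%:R * \sum_i Y (s i) ^+ 2.
pose N (s : {ffun 'I_m -> T}) : R :=
  \sum_(f : {ffun 'I_k.+1 -> 'I_m}) (clique adj [ffun a => s (f a)])%:R.
have m0 : (0 < m)%N.
  by rewrite lt0n; apply/eqP => m0; move: mbig; rewrite m0 mulr0; lra.
have mr1 : (1 : R) <= m%:R by rewrite (ler_nat _ 1).
have c0 : 0 <= 4 * K ^+ 2 * m%:R ^+ 2.
  by apply: mulr_ge0; [apply: mulr_ge0; rewrite ?sqr_ge0 | exact: sqr_ge0].
have FN s : F s <= 4 * K ^+ 2 * m%:R ^+ 2 * N s.
  have N0 : 0 <= N s by apply: sumr_ge0 => f _; exact: ler0n.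
  case: (pickP (fun f : {ffun 'I_k.+1 -> 'I_m} => clique adj [ffun a => s (f a)])).
    move=> f fP.
    have N1 : 1 <= N s.
      by rewrite /N (bigD1 f) //= fP lerDl; apply: sumr_ge0 => g _; rewrite ler0n.
    apply: le_trans (ler_peMr c0 N1).
    have : 0 <= cc * m%:R * \sum_i Y (s i) ^+ 2.
      rewrite mulr_ge0 ?sumr_ge0 // ?mulr_ge0 // => [|i _]; last exact: sqr_ge0.
      by rewrite subr_ge0 invf_le1 ?ltr0n ?ler1n // (leq_trans _ k2).
    rewrite /F => ge0; rewrite lerBlDr; apply: ler_wpDr => //.
    have -> : 4 * K ^+ 2 * m%:R ^+ 2 = \sum_(i < m) \sum_(j < m) 4 * K ^+ 2.
      by rewrite !sumr_const card_ord -[RHS]mulr_natr -[X in _ = X * _]mulr_natr; ring.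
    apply: ler_sum => i _; rewrite big_mkcond; apply: ler_sum => j _.
    by case: ifP => _; [exact: sqr_add_bound | rewrite mulr_ge0 ?sqr_ge0].
  move=> noK.
  apply: (@le_trans _ _ 0); last exact: mulr_ge0.
  have := @weighted_turan R 'I_m (fun i j => adj (s i) (s j)) (fun i => Y (s i)) k.
  rewrite card_ord subr_le0; apply => //.
  - move=> f; have := noK (finfun f); apply: contraFN => /cliqueP fc.
    by apply/cliqueP => a b ab; rewrite !ffunE; apply: fc.
have avgN : avg N <= m%:R ^+ k.+1 * cl.
  rewrite /N avg_sum.
  have -> : m%:R ^+ k.+1 * cl = \sum_(f : {ffun 'I_k.+1 -> 'I_m}) cl.
    by rewrite sumr_const card_ffun !card_ord -[in RHS]mulr_natl natrX.
  apply: ler_sum => f _.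
  (* A repeated index gives no clique because [adj] is irreflexive. *)
  have [f_inj|f_ninj] := boolP (injectiveb f).
    rewrite /cl -(@avg_precomp R _ _ T f (fun x => (clique adj x)%:R)) //.
    exact/injectiveP.
  apply: (@le_trans _ _ 0); last by apply: avg_ge0 => s; rewrite ler0n.
  rewrite -[leRHS](@avg_cst _ {ffun 'I_m -> T}) ?card_ffun_gt0 //.
  apply: ler_avg => s; case: cliqueP => // sc; case/negP: f_ninj.
  apply/injectiveP => a b fab; apply/eqP; apply: contraT => ab.
  by have := sc a b ab; rewrite !ffunE fab irr.
have avgF : eps <= avg F.
  pose a := S / n ^+ 2; pose b := Q / n.
  have Y2 i : avg (fun s : {ffun 'I_m -> T} => Y (s i) ^+ 2) = b.
    by rewrite (avg_proj i (fun x => Y x ^+ 2)).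
  have Y3 i j : i != j -> avg (fun s : {ffun 'I_m -> T} =>
      (adj (s i) (s j))%:R * (Y (s i) + Y (s j)) ^+ 2) = a.
    move=> ij; rewrite (avg_proj2 (fun x y => (adj x y)%:R * (Y x + Y y) ^+ 2)) //.
    rewrite /avg -mulr_suml /a -/n expr2 invfM mulrA; congr (_ / _ / _).
    apply: eq_bigr => u _; rewrite [RHS]big_mkcond; apply: eq_bigr => v _.
    by case: (adj u v); rewrite ?mul1r ?mul0r.
  have A2 : avg (fun s : {ffun 'I_m -> T} => \sum_i Y (s i) ^+ 2) = m%:R * b.
    rewrite avg_sum (eq_bigr (fun=> b)) => [|i _]; last exact: Y2.
    by rewrite sumr_const card_ord mulr_natl.
  have A3 : avg (fun s : {ffun 'I_m -> T} =>
      \sum_i \sum_(j | adj (s i) (s j)) (Y (s i) + Y (s j)) ^+ 2) =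
      m%:R * (m%:R - 1) * a.
    rewrite avg_sum (eq_bigr (fun=> (m%:R - 1) * a)) => [|i _].
      by rewrite sumr_const card_ord -[LHS]mulr_natl mulrA.
    rewrite (@eq_avg R _ _ (fun s : {ffun 'I_m -> T} => \sum_j (adj (s i) (s j))%:R *
       (Y (s i) + Y (s j)) ^+ 2)); last first.
      move=> s; rewrite big_mkcond; apply: eq_bigr => j _.
      by case: (adj _ _); rewrite ?mul1r ?mul0r.
    rewrite avg_sum (bigD1 i) //= [X in X + _](@eq_avg R _ _ (fun=> 0)); last first.
      by move=> s; rewrite irr mul0r.
    rewrite avg_cst ?card_ffun_gt0 // add0r (eq_bigr (fun=> a)) => [|j ji]; last first.
      by rewrite Y3 // eq_sym.
    rewrite sumr_const -[LHS]mulr_natl; congr (_ * _).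
    have -> : #|[pred j | j != i]| = #|'I_m|.-1 by rewrite cardC1.
    by rewrite card_ord -subn1 natrB.
  have -> : avg F = m%:R * (m%:R - 1) * a - cc * m%:R * (m%:R * b).
    rewrite /F avgD A3; congr (_ + _).
    rewrite (@eq_avg R _ _ (fun s : {ffun 'I_m -> T} => (- (cc * m%:R)) *
      \sum_i Y (s i) ^+ 2)) => [|s]; last by rewrite mulNr.
    by rewrite avgZ A2 mulNr.
  have b0 : 0 <= b.
    by apply: divr_ge0; [apply: sumr_ge0 => u _; exact: sqr_ge0 | exact: ltW].
  have b1 : b <= 1 by rewrite ler_pdivrMr // mul1r.
  have ab : (cc + 2 * eps) * b + 2 * eps <= a.
    rewrite ler_pdivlMr ?exprn_gt0 //; apply: le_trans Sbig.
    have -> : Q = b * n by rewrite divfK // gt_eqF.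
    by rewrite /cc le_eqVlt; apply/orP; left; apply/eqP; ring.
  exact: (sample_surplus mr1 mbig).
apply: le_trans avgF _.
apply: le_trans (ler_avg FN) _; rewrite avgZ -[leRHS]mulrA.
exact: ler_wpM2l.
Qed.

End Counting.

(** * Copies of the expansion in a linear hypergraph *)

(** The type [exp_vertex] also contains points [(e, i)] with [e] not an edge of [F], and a copy must
    place these injectively too. They are sent outside the image of [D] by matching enumerations of
    the two complements. *)
Lemma extend_injection (W T : finType) (D : {set W}) (f0 : W -> T) :
    {in D &, injective f0} -> (#|W| <= #|T|)%N ->
  exists f : W -> T, injective f /\ {in D, f =1 f0}.
Proof.
move=> f0inj leWT.
pose f w := if w \in D then f0 w
  else nth (f0 w) (enum (~: (f0 @: D))) (index w (enum (~: D))).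
have idx w : w \notin D -> (index w (enum (~: D)) < size (enum (~: (f0 @: D))))%N.
  move=> wD; have : (index w (enum (~: D)) < size (enum (~: D)))%N.
    by rewrite index_mem mem_enum inE.
  move/leq_trans; apply; rewrite -!cardE.
  have := cardsC D; have := cardsC (f0 @: D); rewrite card_in_imset //; lia.
have fC w : w \notin D -> f w \in ~: (f0 @: D).
  by move=> wD; rewrite /f (negbTE wD) -mem_enum mem_nth // idx.
exists f; split; last by move=> w wD; rewrite /f wD.
move=> w w'; case: (boolP (w \in D)) (boolP (w' \in D)) => wD [] w'D.
- by rewrite /f wD w'D; apply: f0inj.
- move=> E; have := fC _ w'D; rewrite -E /f wD inE => /negP[].
  exact: imset_f.
- move=> E; have := fC _ wD; rewrite E /f w'D inE => /negP[].
  exact: imset_f.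
- rewrite /f (negbTE wD) (negbTE w'D) (set_nth_default (f0 w)) ?idx // => /eqP.
  rewrite nth_uniq ?enum_uniq ?idx // => /eqP.
  by apply: (index_inj w); rewrite mem_enum inE.
Qed.

(** * The shadow graph and closures under hyperedges *)

Section Shadow.
Variables (n r : nat) (H : {set {set 'I_n}}).
Hypotheses (lin : Defs.linear H) (uni : uniform r H).

Definition shadow : rel 'I_n :=
  [rel u v | (u != v) && [exists e in H, (u \in e) && (v \in e)]].

Lemma shadow_sym : symmetric shadow.
Proof.
by move=> u v; rewrite /shadow /= eq_sym; under eq_existsb => e do rewrite [(u \in e) && _]andbC.
Qed.

Lemma shadow_irr : irreflexive shadow.
Proof. by move=> u; rewrite /shadow /= eqxx. Qed.

Lemma card_edge e : e \in H -> #|e| = r.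
Proof. by move=> eH; apply/eqP; move/forall_inP: uni; apply. Qed.

Lemma edge_unique e1 e2 u v : e1 \in H -> e2 \in H -> u != v ->
  u \in e1 -> v \in e1 -> u \in e2 -> v \in e2 -> e1 = e2.
Proof.
move=> e1H e2H uv u1 v1 u2 v2; apply/eqP; apply: contraT => e12.
have := implyP (forall_inP (forall_inP lin e1 e1H) e2 e2H) e12.
suff : (#|[set u; v]| <= #|e1 :&: e2|)%N by rewrite cards2 uv => ? ?; lia.
by apply: subset_leq_card; apply/subsetP => z /set2P[]->; rewrite inE ?u1 ?v1.
Qed.

(* The hyperedge through [a] and [b] if there is one, and [set0] otherwise. *)
Definition hlink (a b : 'I_n) : {set 'I_n} :=
  \bigcup_(e in H | [&& a != b, a \in e & b \in e]) e.

Lemma card_hlink a b : (#|hlink a b| <= r)%N.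
Proof.
have [e /and4P[eH ab ae be]|none] :=
  pickP (fun e => (e \in H) && [&& a != b, a \in e & b \in e]); last first.
  by rewrite /hlink big_pred0 // cards0.
rewrite /hlink (big_pred1 e) ?(card_edge eH) // => e'.
apply/idP/eqP => [/and4P[e'H _ ae' be']|->]; last by rewrite eH ab ae be.
exact: (@edge_unique _ _ a b).
Qed.

Definition hclosure (A : {set 'I_n}) : {set 'I_n} :=
  A :|: \bigcup_(p in setX A A) hlink p.1 p.2.

Lemma sub_hclosure (A : {set 'I_n}) : A \subset hclosure A.
Proof. exact: subsetUl. Qed.

Lemma hclosure_edge (A e : {set 'I_n}) a b : e \in H -> a \in A -> b \in A -> a != b ->
  a \in e -> b \in e -> e \subset hclosure A.
Proof.
move=> eH aA bA ab ae be; apply/subsetP => z ze; rewrite inE; apply/orP; right.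
apply/bigcupP; exists (a, b); first by rewrite inE aA.
by apply/bigcupP; exists e => //=; rewrite eH ab ae be.
Qed.

Lemma card_hclosure (A : {set 'I_n}) m : (#|A| <= m)%N -> (#|hclosure A| <= m + m ^ 2 * r)%N.
Proof.
move=> Am; apply: leq_trans (leq_card_setU _ _) _; apply: leq_add => //.
have : (#|\bigcup_(p in setX A A) hlink p.1 p.2| <= #|setX A A| * r)%N.
  rewrite -sum_nat_const.
  elim/big_ind2: _ => [|X x Z z Xx Zz|p _]; rewrite ?cards0 ?card_hlink //.
  by apply: leq_trans (leq_card_setU _ _) _; apply: leq_add.
move/leq_trans; apply; rewrite cardsX leq_mul2r; apply/orP; right.
by rewrite -mulnn leq_mul.
Qed.

Section Copy.
Variables (V : finType) (adj : rel V).
Hypothesis irr : irreflexive adj.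

(** The first closure absorbs the hyperedges over edges of [F] that avoid [v]; the second absorbs
    the hyperedges joining a point of those to another value of [s]. *)
Definition forbidden (s : {ffun V -> 'I_n}) v := hclosure (hclosure (s @: [set~ v])).

Lemma card_graph_edge e : e \in graph_edges adj ->
  #|e| = 2 /\ forall s : {ffun V -> 'I_n}, (forall u v, adj u v -> shadow (s u) (s v)) ->
  exists2 E, E \in H & s @: e \subset E.
Proof.
rewrite inE => /existsP[u /existsP[v /andP[/eqP-> uv]]].
split=> [|s hom]; first by rewrite cards2; case: eqP uv => // ->; rewrite irr.
have /andP[_ /exists_inP[E EH /andP[uE vE]]] := hom _ _ uv.
by exists E => //; apply/subsetP => _ /imsetP[z /set2P[]-> ->].
Qed.

(* A homomorphism each of whose values avoids the twofold closure of the other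
   values spans hyperedges that meet only where the edges of [F] do. *)
Lemma contains_expansion (s : {ffun V -> 'I_n}) (x0 : 'I_n) : (2 <= r)%N ->
    (forall u v, adj u v -> shadow (s u) (s v)) ->
    (forall v, s v \notin forbidden s v) -> (#|{: exp_vertex V r}| <= n)%N ->
  contains_copy (expansion adj r) H.
Proof.
move=> r2 hom good leWn.
have s_inj : injective s.
  move=> u v suv; apply/eqP; apply: contraT => uv.
  case/negP: (good u); do 2 apply: (subsetP (sub_hclosure _)).
  by rewrite suv imset_f // !inE eq_sym.
pose he (e : {set V}) : {set 'I_n} := odflt set0 [pick E in H | s @: e \subset E].
have heP e : e \in graph_edges adj -> he e \in H /\ s @: e \subset he e.
  move=> eF; have [_ /(_ s hom)[E EH sE]] := card_graph_edge eF.
  by rewrite /he; case: pickP => [E' /andP[]//|/(_ E)]; rewrite EH sE.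
have he_sub e w : e \in graph_edges adj -> w \notin e ->
    he e \subset hclosure (s @: [set~ w]).
  move=> eF we; have [c2 _] := card_graph_edge eF; have [eH se] := heP e eF.
  have /eqP/cards2P[u [v [uv E]]] := c2.
  have inS z : z \in e -> s z \in s @: [set~ w] /\ s z \in he e.
    move=> ze; split; last by rewrite (subsetP se) ?imset_f.
    by rewrite imset_f // !inE; apply: contraNneq we => <-.
  have [? ?] : s u \in s @: [set~ w] /\ s u \in he e.
    by apply: inS; rewrite E !inE eqxx.
  have [? ?] : s v \in s @: [set~ w] /\ s v \in he e.
    by apply: inS; rewrite E !inE eqxx orbT.
  by apply: (@hclosure_edge _ _ (s u) (s v)); rewrite // (inj_eq s_inj).
have fresh_inl e z w : e \in graph_edges adj -> z \in he e :\: s @: e -> z != s w.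
  move=> eF; rewrite inE => /andP[zs ze]; apply: contraNneq (good w) => zw.
  apply: (subsetP (sub_hclosure _)); rewrite -zw.
  apply: (subsetP (he_sub e w eF _)) => //.
  by apply: contraNN zs => we; rewrite zw imset_f.
have fresh_edge e1 e2 z : e1 \in graph_edges adj -> e2 \in graph_edges adj ->
    z \in he e1 :\: s @: e1 -> z \in he e2 -> e1 = e2.
  move=> e1F e2F; rewrite inE => /andP[zs z1] z2; apply/eqP; apply: contraT => e12.
  have [c1 _] := card_graph_edge e1F; have [c2 _] := card_graph_edge e2F.
  (* Both [z] and [s u] lie in the closure of the values at vertices other than [v], so the second
     closure contains [he e1] and with it [s v]. *)
  have [v v1 v2] : exists2 v, v \in e1 & v \notin e2.
    by apply/subsetPn; apply: contraNN e12 => sub; rewrite eqEcard sub c1 c2.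
  have [u ue uv] : exists2 u, u \in e1 & u != v.
    have /card_gt0P[u] : (0 < #|e1 :\ v|)%N by have := cardsD1 v e1; rewrite v1 c1; lia.
    by rewrite !inE => /andP[? ?]; exists u.
  have [e1H se1] := heP _ e1F.
  case/negP: (good v).
  apply: (subsetP (@hclosure_edge (hclosure (s @: [set~ v])) (he e1) z (s u) _ _ _ _ _ _)) => //.
  - by rewrite (subsetP (he_sub e2 v e2F v2)).
  - by rewrite (subsetP (sub_hclosure _)) // imset_f // !inE.
  - by apply: contraNneq zs => ->; rewrite imset_f.
  - by rewrite (subsetP se1) ?imset_f.
  - by rewrite (subsetP se1) ?imset_f.
have card_fresh e : e \in graph_edges adj -> #|he e :\: s @: e| = (r - 2)%N.
  move=> eF; have [eH se] := heP e eF; have [c2 _] := card_graph_edge eF.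
  by rewrite cardsD (setIidPr se) card_imset // c2 card_edge.
pose f0 (w : exp_vertex V r) := match w with
  | inl v => s v | inr (e, i) => nth x0 (enum (he e :\: s @: e)) i end.
pose D := [set w : exp_vertex V r |
  match w with inl _ => true | inr (e, _) => e \in graph_edges adj end].
have f0_fresh e i : e \in graph_edges adj -> f0 (inr (e, i)) \in he e :\: s @: e.
  by move=> eF; rewrite -mem_enum mem_nth // -cardE card_fresh.
have inlD v : inl v \in D by rewrite in_set.
have inrD e i : (inr (e, i) \in D) = (e \in graph_edges adj) by rewrite in_set.
have f0_inj : {in D &, injective f0}.
  move=> [v|[e i]] [v'|[e' i']]; rewrite ?inrD => wD w'D.
  - by move=> /s_inj ->.
  - by move=> E; have := fresh_inl _ _ v w'D (f0_fresh e' i' w'D); rewrite -E eqxx.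
  - by move=> E; have := fresh_inl _ _ v' wD (f0_fresh e i wD); rewrite E eqxx.
  - move=> E; have ee' : e = e'.
      apply: (fresh_edge _ _ _ wD w'D (f0_fresh e i wD)).
      by rewrite E; have := f0_fresh e' i' w'D; rewrite inE => /andP[].
    move: E; rewrite -ee' /= => /eqP; rewrite nth_uniq ?enum_uniq -?cardE ?card_fresh //.
    by move=> /eqP/val_inj ->.
have [f [f_inj fD]] := extend_injection f0_inj (leq_trans leWn (eq_leq (esym (card_ord n)))).
exists f; split => // _ /imsetP[e eF ->].
have [eH se] := heP e eF; have [c2 _] := card_graph_edge eF.
(* One inclusion suffices: both sides have [2 + (r - 2)] points. *)
suff -> : f @: ([set inl x | x in e] :|: [set inr (e, i) | i : 'I_(r - 2)]) = he e by [].
apply/eqP; rewrite eqEcard; apply/andP; split.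
  apply/subsetP => _ /imsetP[w wE ->]; case/setUP: wE => /imsetP[x xe ->].
    by rewrite (fD _ (inlD _)) /= (subsetP se) ?imset_f.
  by rewrite fD ?inrD //; have := f0_fresh e x eF; rewrite inE => /andP[].
rewrite card_imset // cardsU (card_edge eH).
rewrite (_ : _ :&: _ = set0) ?cards0; last first.
  apply/setP => w; rewrite !inE; apply/negP => /andP[/imsetP[x _ ->] /imsetP[y _]].
  by [].
rewrite !card_imset; first by rewrite c2 card_ord; lia.
- by move=> i j [].
- by move=> x y [].
Qed.

Variable R : realFieldType.

Definition forbidden_bound (r v : nat) := let m := (v + v ^ 2 * r)%N in (m + m ^ 2 * r)%N.

(** The set [forbidden s v] does not depend on [s v], so [s v] is uniform and independent of it; a
    union bound over [v] follows. *)
Lemma forbidden_density : (0 < n)%N ->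
  avg (fun s : {ffun V -> 'I_n} => [exists v, s v \in forbidden s v]%:R : R) <=
  #|V|%:R * ((forbidden_bound r #|V|)%:R / n%:R).
Proof.
move=> n0; have T0 : (0 < #|'I_n|)%N by rewrite card_ord.
apply: (@le_trans _ _ (avg (fun s : {ffun V -> 'I_n} =>
    \sum_v (s v \in forbidden s v)%:R))).
  apply: ler_avg => s; case: existsP => [[v sv]|_]; last first.
    by apply: sumr_ge0 => v _; rewrite ler0n.
  by rewrite (bigD1 v) //= sv lerDl; apply: sumr_ge0 => u _; rewrite ler0n.
rewrite avg_sum -[X in X%:R * _]sum1_card natr_sum mulr_suml; apply: ler_sum => v _; rewrite mul1r.
pose put (s : {ffun V -> 'I_n}) x : {ffun V -> 'I_n} :=
  [ffun l => if l == v then x else s l].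
have putE s x : put s x @: [set~ v] = s @: [set~ v].
  by apply: eq_in_imset => u; rewrite !inE ffunE => /negbTE ->.
rewrite (@avg_lens _ _ _ (fun s : {ffun V -> 'I_n} => s v) put
  (fun s x => (x \in forbidden s v)%:R)) ?card_ffun_gt0 //; last first.
- by move=> s x x'; rewrite /forbidden putE.
- by move=> s x; apply/ffunP => l; rewrite !ffunE; case: eqP => // ->.
- by move=> s x; rewrite ffunE eqxx.
rewrite -[leRHS](@avg_cst _ {ffun V -> 'I_n}) ?card_ffun_gt0 //.
apply: ler_avg => s; rewrite /avg card_ord ler_pM2r ?invr_gt0 ?ltr0n //.
have -> : \sum_x (x \in forbidden s v)%:R = #|forbidden s v|%:R :> R.
  by rewrite -sum1_card natr_sum [RHS]big_mkcond; apply: eq_bigr => x _; case: ifP.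
have cA : (#|s @: [set~ v]| <= #|V|)%N.
  by rewrite (leq_trans (leq_imset_card _ _)) // max_card.
by rewrite ler_nat; apply: card_hclosure (card_hclosure cA).
Qed.

End Copy.
End Shadow.

(** * Upper bound *)

Section Upper.
Variable R : realType.

(* The hypothesis [1 <= (c - 1) * K] makes lowering an entry above [K] profitable:
   the loss in the form is at most [n * (Y u ^+ 2 - K ^+ 2)] plus a linear term. *)
Lemma truncation_surplus (T : finType) (adj : rel T) (Y Z : T -> R) (c K : R) :
    symmetric adj -> (forall u, 0 <= Y u) -> \sum_u Y u ^+ 2 = #|T|%:R ->
    0 <= K -> 1 <= (c - 1) * K -> (forall u, Z u = Num.min (Y u) K) ->
  \sum_u \sum_(v | adj u v) (Y u + Y v) ^+ 2 - 2 * c * #|T|%:R * \sum_u Y u ^+ 2 <=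
  \sum_u \sum_(v | adj u v) (Z u + Z v) ^+ 2 - 2 * c * #|T|%:R * \sum_u Z u ^+ 2.
Proof.
move=> sym Y0 YQ K0 cK ZE; set n : R := #|T|%:R in YQ *.
have n0 : 0 <= n by rewrite ler0n.
have ZY u : Z u <= Y u by rewrite ZE ge_min lexx.
have Z0 u : 0 <= Z u by rewrite ZE le_min Y0.
pose d u := Y u - Z u; pose s u := Y u + Z u.
have d0 u : 0 <= d u by rewrite subr_ge0.
have s0 u : 0 <= s u by rewrite addr_ge0.
have Ysum : \sum_u Y u <= n.
  have : \sum_u Y u <= \sum_u (Y u ^+ 2 + 1) / 2.
    apply: ler_sum => u _; have : 0 <= (Y u - 1) ^+ 2 by rewrite sqr_ge0.
    by rewrite sqrrB1; lra.
  rewrite -mulr_suml big_split /= YQ sumr_const -/n; lra.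
have ssum : \sum_u s u <= 2 * n.
  have : \sum_u Z u <= \sum_u Y u by apply: ler_sum.
  by rewrite big_split /=; lra.
have E1 : \sum_u \sum_(v | adj u v) (Y u + Y v) ^+ 2
   - \sum_u \sum_(v | adj u v) (Z u + Z v) ^+ 2 =
   2 * \sum_u \sum_(v | adj u v) d u * (s u + s v).
  rewrite -sumrB.
  under eq_bigr => u _.
    rewrite -sumrB.
    under eq_bigr => v _.
      have -> : (Y u + Y v) ^+ 2 - (Z u + Z v) ^+ 2 =
        d u * (s u + s v) + d v * (s v + s u) by rewrite /d /s; ring.
      over.
    rewrite big_split /=; over.
  rewrite big_split /= [X in _ + X = _](_ : _ = \sum_u \sum_(v | adj u v) d u * (s u + s v)).
    by rewrite mulr_natl mulr2n.
  rewrite (exchange_big_dep xpredT) //=; apply: eq_bigr => u _.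
  by apply: eq_bigl => v; rewrite sym.
have E2 : \sum_u Y u ^+ 2 - \sum_u Z u ^+ 2 = \sum_u d u * s u.
  by rewrite -sumrB; apply: eq_bigr => u _; rewrite /d /s; ring.
suff : \sum_u \sum_(v | adj u v) d u * (s u + s v) <= c * n * \sum_u d u * s u.
  rewrite -E2; move: E1.
  set S1 := \sum_u \sum_(v | _) (Y u + _) ^+ 2; set S2 := \sum_u \sum_(v | _) (Z u + _) ^+ 2.
  by lra.
rewrite mulr_sumr; apply: ler_sum => u _.
have : \sum_(v | adj u v) d u * (s u + s v) <= d u * (n * s u + 2 * n).
  apply: (@le_trans _ _ (\sum_v d u * (s u + s v))).
    rewrite big_mkcond; apply: ler_sum => v _; case: ifP => // _.
    by apply: mulr_ge0 => //; apply: addr_ge0.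
  rewrite -mulr_sumr ler_wpM2l // big_split /= sumr_const -/n lerD //.
  by rewrite -[_ *+ _]mulr_natl.
move/le_trans; apply.
(* Entries up to [K] are unchanged. For the others [s u] is at least [2 * K], so the linear loss
   [2 * n] is at most [(c - 1) * n * s u]. *)
have [YK|YK] := leP (Y u) K.
  have -> : d u = 0 by rewrite /d ZE min_l // subrr.
  by rewrite !mul0r mulr0.
have su : 2 * K <= s u by rewrite /s ZE min_r ?(ltW YK) //; lra.
have c1 : 0 <= c - 1.
  rewrite leNgt; apply/negP => c1.
  have : (c - 1) * K <= 0 by rewrite mulr_le0_ge0 // ltW.
  lra.
have : 2 <= (c - 1) * s u.
  by have := ler_wpM2l c1 su; lra.
move=> h; have := ler_wpM2l n0 h => {}h.
have := ler_wpM2l (d0 u) h; lra.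
Qed.

(** The arithmetic-geometric mean inequality over the [r * r.-1] ordered pairs in [e]: each [y u]
    occurs [2 * r.-1] times, so the product of all [y u * y v] is the power [r * r.-1] of the
    product of the [a v]. *)
Lemma edge_amgm (T : finType) (e : {set T}) (a y : T -> R) r :
    #|e| = r -> (2 <= r)%N -> (forall v, 0 <= a v) -> (forall v, 0 <= y v) ->
    (forall v, y v ^+ 2 = a v ^+ r) ->
  r%:R * \prod_(v in e) a v <=
  (\sum_(u in e) \sum_(v in e | v != u) y u * y v) / (r%:R - 1).
Proof.
move=> er r2 a0 y0 ya.
pose A := [set p : T * T | [&& p.1 \in e, p.2 \in e & p.2 != p.1]].
pose E (p : T * T) := y p.1 * y p.2.
have cA : #|A| = (r * r.-1)%N.
  rewrite -sum1_card
    (eq_bigl (fun p : T * T => (p.1 \in e) && ((p.2 \in e) && (p.2 != p.1)))); last first.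
    by move=> p; rewrite inE.
  rewrite -(pair_big_dep (mem e) (fun u v => (v \in e) && (v != u)) (fun _ _ => 1%N)) /=.
  rewrite (eq_bigr (fun=> r.-1)) => [|u ue]; first by rewrite sum_nat_const er.
  rewrite sum1_card -er (cardsD1 u e) ue /=; apply: eq_card => v.
  by rewrite !inE andbC.
have sumE : \sum_(p in A) E p = \sum_(u in e) \sum_(v in e | v != u) y u * y v.
  rewrite pair_big_dep /=; apply: eq_bigl => p; by rewrite inE.
have c0 : (0 < r * r.-1)%N by rewrite muln_gt0; lia.
have cardD u : u \in e -> #|[pred v in e | v != u]| = r.-1.
  move=> ue; rewrite -er (cardsD1 u e) ue /=; apply: eq_card => v.
  by rewrite !inE andbC.
have prodE : \prod_(p in A) E p = (\prod_(v in e) a v) ^+ (r * r.-1).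
  rewrite (eq_bigl (fun p : T * T => (p.1 \in e) && ((p.2 \in e) && (p.2 != p.1)))); last first.
    by move=> p; rewrite inE.
  rewrite -(pair_big_dep (mem e) (fun u v => (v \in e) && (v != u)) (fun u v => y u * y v)) /=.
  under eq_bigr => u _ do rewrite big_split /=.
  rewrite big_split /= [X in _ * X](exchange_big_dep (mem e)) /=; last by move=> ? ? _ /andP[].
  rewrite (eq_bigr (fun u => y u ^+ r.-1)) => [|u ue]; last first.
    by rewrite prodr_const cardD.
  rewrite [X in _ * X](eq_bigr (fun u => y u ^+ r.-1)) => [|u ue]; last first.
    rewrite prodr_const; congr (_ ^+ _); rewrite -(cardD u ue); apply: eq_card => v.
    by rewrite !inE ue /= eq_sym.
  rewrite -big_split -prodrXl /=; apply: eq_bigr => u _.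
  by rewrite -expr2 -exprM mulnC exprM ya -exprM.
have := (@leif_AGM R _ A E _).1.
rewrite cA prodE sumE => /(_ (fun p _ => mulr_ge0 (y0 _) (y0 _))).
set S := \sum_(u in e) _ => agm.
have S0 : 0 <= S by apply: sumr_ge0 => u _; apply: sumr_ge0 => v _; apply: mulr_ge0.
have rr : 0 < r%:R - 1 :> R by rewrite subr_gt0 ltr1n.
move: agm; rewrite ler_pXn2r ?nnegrE ?divr_ge0 ?prodr_ge0 // => agm.
rewrite ler_pdivlMr // mulrAC mulrC -ler_pdivlMr; last by rewrite mulr_gt0 // ltr0n; lia.
apply: le_trans agm _; rewrite natrM -subn1 natrB //; lia.
Qed.

(** * From the hypergraph form to the shadow graph *)

Section Reduction.
Variables (n r : nat) (H : {set {set 'I_n}}).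
Hypotheses (lin : Defs.linear H) (uni : uniform r H) (r2 : (2 <= r)%N).

Lemma sum_edge_pairs (F : 'I_n -> 'I_n -> R) : (forall u v, 0 <= F u v) ->
  \sum_(e in H) \sum_(u in e) \sum_(v in e | v != u) F u v <=
  \sum_u \sum_(v | shadow H u v) F u v.
Proof.
move=> F0.
have -> : \sum_(e in H) \sum_(u in e) \sum_(v in e | v != u) F u v =
  \sum_u \sum_v \sum_(e in H | [&& u \in e, v \in e & v != u]) F u v.
  rewrite (exchange_big_dep xpredT) //=; apply: eq_bigr => u _.
  rewrite (exchange_big_dep xpredT) //=; apply: eq_bigr => v _.
  by apply: eq_bigl => e; rewrite -!andbA.
apply: ler_sum => u _; rewrite [leRHS]big_mkcond; apply: ler_sum => v _.
have [e /and4P[eH ue ve uv]|none] :=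
    pickP (fun e => (e \in H) && [&& u \in e, v \in e & v != u]); last first.
  by rewrite big_pred0 //; case: ifP.
rewrite (big_pred1 e) => [|e'].
  by rewrite /shadow /= eq_sym uv (_ : [exists _ in _, _]) //;
    apply/exists_inP; exists e => //; rewrite ue.
apply/idP/eqP => [/and4P[e'H ue' ve' _]|->]; last by rewrite eH ue ve.
by apply: (edge_unique lin uni e'H eH _ ue' ve' ue ve); rewrite eq_sym.
Qed.

(* Each pair of vertices lies in at most one hyperedge, so the pairs inside the
   hyperedges are the edges of the shadow, each counted once. *)
Lemma form_le_shadow (x y : 'I_n -> R) :
    (forall v, 0 <= y v) -> (forall v, y v ^+ 2 = `|x v| ^+ r) ->
  \sum_(v < n) (degree H v)%:R * x v ^+ r + r%:R * \sum_(e in H) \prod_(v in e) x v <=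
  (\sum_u \sum_(v | shadow H u v) (y u + y v) ^+ 2) / (2 * (r%:R - 1)).
Proof.
move=> y0 yx.
have rr : 0 < r%:R - 1 :> R by rewrite subr_gt0 ltr1n.
apply: (@le_trans _ _ ((\sum_(e in H) \sum_(u in e) \sum_(v in e | v != u)
    (y u + y v) ^+ 2) / (2 * (r%:R - 1)))); last first.
  rewrite ler_pM2r ?invr_gt0 ?mulr_gt0 //.
  by apply: sum_edge_pairs => u v; apply: sqr_ge0.
have -> : \sum_(v < n) (degree H v)%:R * x v ^+ r =
    \sum_(e in H) \sum_(v in e) x v ^+ r.
  rewrite (exchange_big_dep xpredT) //=; apply: eq_bigr => v _.
  rewrite mulr_natl -sumr_const; apply: eq_bigl => e; by rewrite inE.
rewrite mulr_sumr -big_split /= mulr_suml; apply: ler_sum => e eH.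
have er := card_edge uni eH.
have amgm := edge_amgm er r2 (fun v => normr_ge0 (x v)) y0 yx.
have le1 : \sum_(v in e) x v ^+ r <= \sum_(v in e) y v ^+ 2.
  by apply: ler_sum => v _; rewrite yx -normrX ler_norm.
have le2 : r%:R * \prod_(v in e) x v <= r%:R * \prod_(v in e) `|x v|.
  by rewrite ler_wpM2l // -normr_prod ler_norm.
have cardD u : u \in e -> #|[pred v in e | v != u]| = r.-1.
  move=> ue; rewrite -er (cardsD1 u e) ue /=; apply: eq_card => v.
  by rewrite !inE andbC.
have r1 : (r.-1)%:R = r%:R - 1 :> R by rewrite -subn1 natrB //; lia.
(* After division by [2 * (r%:R - 1)] the squares bound the degree term and the cross terms bound
   the product, by [edge_amgm]. *)
have -> : \sum_(u in e) \sum_(v in e | v != u) (y u + y v) ^+ 2 =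
    2 * ((r%:R - 1) * \sum_(u in e) y u ^+ 2) +
    2 * \sum_(u in e) \sum_(v in e | v != u) y u * y v.
  have sq : \sum_(u in e) \sum_(v in e | v != u) y u ^+ 2 =
            (r%:R - 1) * \sum_(u in e) y u ^+ 2.
    rewrite mulr_sumr; apply: eq_bigr => u ue.
    by rewrite sumr_const cardD // -[LHS]mulr_natl r1.
  have sq' : \sum_(u in e) \sum_(v in e | v != u) y v ^+ 2 =
             (r%:R - 1) * \sum_(u in e) y u ^+ 2.
    rewrite -sq (exchange_big_dep (mem e)) /=; last by move=> ? ? _ /andP[].
    apply: eq_bigr => u ue; apply: eq_bigl => v.
    by rewrite ue /= eq_sym.
  transitivity (\sum_(u in e) \sum_(v in e | v != u) y u ^+ 2 +
    \sum_(u in e) \sum_(v in e | v != u) y v ^+ 2 +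
    2 * \sum_(u in e) \sum_(v in e | v != u) y u * y v).
    rewrite mulr_sumr -!big_split /=; apply: eq_bigr => u _.
    by rewrite mulr_sumr -!big_split /=; apply: eq_bigr => v _; ring.
  by rewrite sq sq'; ring.
rewrite -mulrDr invfM mulrACA divff ?pnatr_eq0 // mul1r mulrDl mulrAC divff ?gt_eqF // mul1r.
lra.
Qed.

End Reduction.

Lemma shadow_bound (V : finType) (adj : rel V) k r (eps : R) :
    irreflexive adj -> colorable adj k.+1 -> (2 <= k)%N -> (2 <= r)%N -> 0 < eps ->
  exists N : nat, forall n (H : {set {set 'I_n}}), (N <= n)%N ->
    Defs.linear H -> uniform r H -> ~ contains_copy (expansion adj r) H ->
    forall Y : 'I_n -> R, (forall u, 0 <= Y u) -> \sum_u Y u ^+ 2 = n%:R ->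
    \sum_u \sum_(v | shadow H u v) (Y u + Y v) ^+ 2 <=
      2 * (2 * (1 - k%:R^-1) + 2 * eps) * n%:R ^+ 2.
Proof.
move=> irr /existsP[col /forallP colP] k2 r2 e0.
(* The sample size, chosen for the last hypothesis of [clique_density]. *)
pose m := (Num.bound ((4 + 4 * eps) / eps)).
have mbig : 4 + 4 * eps <= eps * m%:R.
  rewrite [leRHS]mulrC -ler_pdivrMr //; apply: ltW; rewrite /m archi_boundP //.
  by rewrite divr_ge0 ?ltW //; lra.
have m0 : 0 < m%:R :> R.
  by rewrite -(pmulr_rgt0 _ e0); apply: lt_le_trans mbig; lra.
(* The truncation level: [1 <= (c - 1) * K] holds because [c - 1 >= eps] for [k >= 2]. *)
pose K := eps^-1.
have K0 : 0 < K by rewrite invr_gt0.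
pose B := 4 * K ^+ 2 * m%:R ^+ 2 * m%:R ^+ k.+1.
have B0 : 0 < B by rewrite !mulr_gt0 ?exprn_gt0.
(* A lower bound for the density of homomorphisms from [F]; for large [n] the maps with a forbidden
   value have smaller density. *)
pose del := (eps / B) ^+ (#|V| ^ k.+1).
have del0 : 0 < del by rewrite exprn_gt0 // divr_gt0.
pose fb : R := #|V|%:R * (forbidden_bound r #|V|)%:R.
exists (maxn 1 (maxn #|{: exp_vertex V r}| (Num.bound (fb / del)).+1)) => n H.
rewrite !geq_max => /and3P[n1 nW nfb] lin uni nocopy Y Y0 YQ.
rewrite leNgt; apply/negP => big.
have T0 : (0 < #|'I_n|)%N by rewrite card_ord.
pose c := 2 * (1 - k%:R^-1) + eps.
have c1 : eps <= c - 1.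
  have : k%:R^-1 <= 2^-1 :> R by rewrite lef_pV2 ?posrE ?ltr0n ?(ler_nat _ 2) //; lia.
  by rewrite /c; lra.
have cK : 1 <= (c - 1) * K by rewrite -ler_pdivrMr // div1r invrK.
pose Z u := Num.min (Y u) K.
have Z0 u : 0 <= Z u by rewrite le_min Y0 ltW.
have ZK u : Z u <= K by rewrite ge_min lexx orbT.
have YQ' : \sum_u Y u ^+ 2 = #|'I_n|%:R by rewrite card_ord.
have trunc := truncation_surplus (shadow_sym H) Y0 YQ' (ltW K0) cK (fun u => erefl (Z u)).
have ZQ : \sum_u Z u ^+ 2 <= #|'I_n|%:R.
  rewrite -YQ'; apply: ler_sum => u _; rewrite ler_sqr ?nnegrE //.
  by rewrite ge_min lexx.
(* Of the excess [2 * eps] in the negated claim, one [eps] is part of [c] and the other is the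
   surplus that survives truncation. *)
have ZS : 2 * c * #|'I_n|%:R * (\sum_u Z u ^+ 2) + 2 * eps * #|'I_n|%:R ^+ 2 <=
    \sum_u \sum_(v | shadow H u v) (Z u + Z v) ^+ 2.
  move: trunc big; rewrite YQ' card_ord /c expr2; lra.
have Zb u : 0 <= Z u <= K by rewrite Z0 ZK.
have := clique_density (shadow_sym H) (shadow_irr H) k2 e0 T0 Zb ZQ ZS mbig.
rewrite -/B mulrC -ler_pdivrMr // => clq.
have colV u v : adj u v -> col u != col v.
  by move=> uv; have /forallP/(_ v)/implyP := colP u; apply.
have := hom_density R (shadow H) T0 colV.
set hd := (X in _ <= X) => hdle.
have hd_del : del <= hd.
  apply: le_trans hdle; apply: lerXn2r => //; rewrite nnegrE.
    by rewrite divr_ge0 ?ltW.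
  by apply: avg_ge0 => s; rewrite ler0n.
have bad := @forbidden_density _ _ _ lin uni V R n1.
have bad_del : #|V|%:R * ((forbidden_bound r #|V|)%:R / n%:R) < del.
  rewrite mulrA -/fb ltr_pdivrMr ?ltr0n // mulrC -ltr_pdivrMr //.
  have fb0 : 0 <= fb / del by rewrite divr_ge0 ?mulr_ge0 // ltW.
  apply: lt_le_trans (archi_boundP fb0) _; rewrite ler_nat; exact: ltnW.
have [s] : exists s : {ffun V -> 'I_n},
    [forall u, forall v, adj u v ==> shadow H (s u) (s v)] &&
    ~~ [exists v, s v \in forbidden H s v].
  apply/existsP; apply: contraT; rewrite negb_exists => /forallP none.
  have : hd <= avg (fun s : {ffun V -> 'I_n} => [exists v, s v \in forbidden H s v]%:R).
    apply: ler_avg => s; rewrite ler_nat; have := none s.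
    by case: [forall u, _] => //=; rewrite negbK => ->.
  move/(le_trans hd_del)/le_trans/(_ bad); rewrite leNgt bad_del //.
rewrite negb_exists => /andP[/forallP hom /forallP good].
apply: nocopy; apply: (@contains_expansion _ _ _ lin uni _ _ irr s (Ordinal n1)) => //.
by move=> u v uv; have /forallP/(_ v)/implyP := hom u; apply.
Qed.

End Upper.

(** * Cyclotomic classes *)

Lemma card_bigcup_le (I T : finType) (P : pred I) (B : I -> {set T}) m :
  (forall i, P i -> (#|B i| <= m)%N) -> (#|\bigcup_(i | P i) B i| <= #|P| * m)%N.
Proof.
move=> Bm; rewrite -sum_nat_const.
elim/big_ind2: _ => [|X x Z z Xx Zz|i Pi]; rewrite ?cards0 ?Bm //.
by apply: leq_trans (leq_card_setU _ _) _; apply: leq_add.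
Qed.

Section Cyclotomy.
Variables (F : finFieldType) (D e : nat).
Hypothesis FDe : #|F|.-1 = (D * e)%N.

Lemma cyclotomy_gt0 : (0 < D)%N /\ (0 < e)%N.
Proof. by have := card_finRing_gt1 F; rewrite -subn_gt0 subn1 FDe muln_gt0 => /andP. Qed.

(** The sets [class w] with [w] in [uroots] are the cosets of the subgroup of order [e] and index
    [D] in the units; a coset is named by the common [e]-th power of its elements. *)
Definition uroots : {set F} := [set w | w ^+ D == 1].
Definition class (w : F) : {set F} := [set x | x ^+ e == w].

Lemma card_xn_eq (m : nat) (w : F) : (0 < m)%N ->
  (#|[set x : F | x ^+ m == w]| <= m)%N.
Proof.
move=> m0; rewrite cardE.
have p0 : 'X^m - w%:P != 0 :> {poly F}.
  by rewrite -size_poly_eq0 size_XnsubC.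
have := max_poly_roots p0 _ (enum_uniq _); rewrite size_XnsubC //; apply.
by apply/allP => x; rewrite mem_enum inE /root !hornerE subr_eq0.
Qed.

Lemma uroot_neq0 w : w \in uroots -> w != 0.
Proof.
rewrite inE; apply: contraTneq => ->.
by rewrite expr0n gtn_eqF ?cyclotomy_gt0.1 // eq_sym oner_eq0.
Qed.

Lemma mem_class_neq0 w x : w \in uroots -> x \in class w -> x != 0.
Proof.
move=> wU; rewrite inE; apply: contraTneq => ->.
by rewrite expr0n gtn_eqF ?cyclotomy_gt0.2 // eq_sym uroot_neq0.
Qed.

Lemma expe_uroot x : x != 0 -> x ^+ e \in uroots.
Proof.
move=> x0; rewrite inE -exprM mulnC -FDe; apply/eqP/(mulfI x0).
by rewrite -exprS prednK ?mulr1 ?expf_card // (ltn_trans _ (card_finRing_gt1 F)).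
Qed.

Lemma card_units_classes : #|F|.-1 = (\sum_(w in uroots) #|class w|)%N.
Proof.
transitivity #|[set~ (0 : F)]|; first by rewrite cardsC1.
rewrite -sum1_card (partition_big (fun x => x ^+ e) (mem uroots)) /=; last first.
  by move=> x; rewrite !inE => /expe_uroot; rewrite inE.
apply: eq_bigr => w wU; rewrite -sum1_card; apply: eq_bigl => x.
rewrite !inE; apply: andb_idl => xw; apply: (mem_class_neq0 wU).
by rewrite inE.
Qed.

(** Root counting allows at most [D] names and at most [e] elements per class; the [D * e] units
    force equality. *)
Lemma card_uroots : #|uroots| = D.
Proof.
have [D0 e0] := cyclotomy_gt0.
apply/eqP; rewrite eqn_leq card_xn_eq //= -(leq_pmul2r e0) -FDe card_units_classes.
by rewrite -sum_nat_const; apply: leq_sum => w _; apply: card_xn_eq.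
Qed.

Lemma card_class w : w \in uroots -> #|class w| = e.
Proof.
move=> wU; have [D0 e0] := cyclotomy_gt0.
apply/eqP; rewrite eqn_leq card_xn_eq //=.
have := card_units_classes; rewrite FDe (bigD1 w) //=.
have : (\sum_(i in uroots | i != w) #|class i| <= \sum_(i in uroots | i != w) e)%N.
  by apply: leq_sum => i _; apply: card_xn_eq.
have : (\sum_(i in uroots) e = D * e)%N by rewrite sum_nat_const card_uroots.
by rewrite (bigD1 w) //=; lia.
Qed.

Section Variance.
Variable X : {set F}.

Let f (w c : F) : nat := #|[set y in X | y - c \in class w]|.

Let fE w c : f w c = (\sum_(y in X) ((y - c)%R \in class w))%N.
Proof.
rewrite /f -sum1_card big_mkcond [RHS]big_mkcond /=; apply: eq_bigr => y _.
by rewrite inE; case: (y \in X) => //=; case: (_ \in class w).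
Qed.

Lemma class_first_moment w : w \in uroots -> (\sum_c f w c = #|X| * e)%N.
Proof.
move=> wU; under eq_bigr => c _ do rewrite fE.
rewrite exchange_big /= -sum_nat_const; apply: eq_bigr => y _.
rewrite -(card_class wU) -sum1_card [RHS]big_mkcond /=.
rewrite (reindex_inj (can_inj (fun c : F => subKr y c))) /=.
by apply: eq_bigr => c _; rewrite subKr; case: ifP.
Qed.

(** The left side counts the triples [(y, y', c)] with [y - c] and [y' - c] in one class. For
    [y != y'] the map sending [c] to [(y - c) / (y' - c)] is injective with values in the class of
    1, so at most [e] values of [c] occur. *)
Lemma class_second_moment :
  (\sum_(w in uroots) \sum_c f w c ^ 2 <= #|X| * #|F| + #|X| ^ 2 * e)%N.
Proof.
pose N (y y' : F) := #|[set c | [&& y - c != 0, y' - c != 0 & (y - c) ^+ e == (y' - c) ^+ e]]|.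
have Nle y y' : (N y y' <= (y == y') * #|F| + e)%N.
  have [->|yy'] := eqVneq y y'; first by rewrite mul1n (leq_trans (max_card _)) ?leq_addr.
  have wU1 : 1 \in uroots by rewrite inE expr1n.
  rewrite mul0n add0n -(card_class wU1).
  rewrite /N; set B := [set c | _]; pose g c := (y - c) / (y' - c).
  have g_inj : {in B &, injective g}.
    have gE z : y' - z != 0 -> g z = 1 + (y - y') / (y' - z) by move=> z0; rewrite /g; field.
    move=> c d; rewrite !inE => /and3P[_ y'c _] /and3P[_ y'd _].
    rewrite !gE // => /addrI/mulfI; rewrite subr_eq0 => /(_ yy')/invr_inj.
    by move/addrI/oppr_inj.
  rewrite -(card_in_imset g_inj).
  apply: subset_leq_card; apply/subsetP => z /imsetP[c cB ->].
  move: cB; rewrite !inE => /and3P[yc y'c /eqP E].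
  by rewrite expr_div_n E divff // expf_neq0.
have E : (\sum_(w in uroots) \sum_c f w c ^ 2 <= \sum_(y in X) \sum_(y' in X) N y y')%N.
  have -> : (\sum_(y in X) \sum_(y' in X) N y y' =
    \sum_c \sum_(y in X) \sum_(y' in X)
      [&& y - c != 0, y' - c != 0 & (y - c) ^+ e == (y' - c) ^+ e]%R)%N.
    rewrite [RHS]exchange_big; apply: eq_bigr => y _.
    rewrite [RHS]exchange_big; apply: eq_bigr => y' _.
    by rewrite /N -sum1_card [LHS]big_mkcond; apply: eq_bigr => c _; rewrite inE; case: ifP.
  rewrite exchange_big; apply: leq_sum => c _.
  under eq_bigr => w _ do rewrite -mulnn fE big_distrl.
  rewrite exchange_big; apply: leq_sum => y _ /=.
  under eq_bigr => w _ do rewrite big_distrr.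
  rewrite exchange_big; apply: leq_sum => y' _ /=.
  have [yc|yc] := eqVneq (y - c) 0.
    rewrite big1 // => w wU; case: (boolP (y - c \in class w)) => // h.
    by have := mem_class_neq0 wU h; rewrite yc eqxx.
  rewrite (bigD1 ((y - c) ^+ e)) ?expe_uroot //= big1 ?addn0 => [|w /andP[wU wy]]; last first.
    by rewrite [_ \in class w]inE eq_sym (negbTE wy).
  rewrite !inE eqxx mul1n [_ == (y - c) ^+ e]eq_sym.
  have [y'c|//] := eqVneq (y' - c) 0; rewrite y'c expr0n gtn_eqF ?cyclotomy_gt0.2 //.
  by rewrite expf_eq0 (negbTE yc) andbF.
apply: leq_trans E _.
apply: (@leq_trans (\sum_(y in X) (#|F| + #|X| * e))); last first.
  by rewrite sum_nat_const mulnDr mulnA mulnn.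
apply: leq_sum => y yX.
apply: (@leq_trans (\sum_(y' in X) ((y == y') * #|F| + e))); first exact: leq_sum.
rewrite big_split /= sum_nat_const leq_add2r (bigD1 y) //= eqxx mul1n big1 ?addn0 //.
by move=> y' /andP[_ /negbTE]; rewrite eq_sym => ->.
Qed.

(* Chebyshev, the variance being averaged over all classes [w]: only the sum
   over [w] of the second moments has an elementary evaluation. *)
Lemma card_irregular w : w \in uroots ->
  (#|[set c | (2 * D * f w c < #|X|)%N]| * #|X| <= 8 * D ^ 2 * #|F|)%N.
Proof.
move=> wU; set Bad := [set c | _]; set n := #|X|; set q := #|F|.
have [n0|npos] := posnP n; first by rewrite n0 muln0.
have [D0 e0] := cyclotomy_gt0.
have nq : (n <= q)%N by apply: max_card.
pose dev (v c : F) : rat := (D%:R * (f v c)%:R - n%:R) ^+ 2.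
have devE : \sum_(v in uroots) \sum_c dev v c =
   D%:R ^+ 2 * (\sum_(v in uroots) \sum_c f v c ^ 2)%N%:R
   - 2 * n%:R * D%:R * (D * (n * e))%N%:R + D%:R * (q%:R * n%:R ^+ 2).
  have -> : (D * (n * e))%N%:R = \sum_(v in uroots) \sum_c (f v c)%:R :> rat.
    rewrite (eq_bigr (fun=> (n * e)%N%:R)) => [|v vU].
      by rewrite sumr_const card_uroots -[RHS]mulr_natl natrM.
    by rewrite -natr_sum class_first_moment.
  have -> : D%:R * (q%:R * n%:R ^+ 2) = \sum_(v in uroots) \sum_(c : F) n%:R ^+ 2 :> rat.
    by rewrite !sumr_const card_uroots -[RHS]mulr_natl -[in RHS](mulr_natl (n%:R ^+ 2)).
  rewrite natr_sum !mulr_sumr -sumrB -big_split /=; apply: eq_bigr => v _.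
  rewrite natr_sum !mulr_sumr -sumrB -big_split /=; apply: eq_bigr => c _.
  by rewrite /dev natrX; ring.
have devle : \sum_(v in uroots) \sum_c dev v c <= 2 * D%:R ^+ 2 * n%:R * q%:R.
  rewrite devE.
  have h : (\sum_(v in uroots) \sum_c f v c ^ 2)%N%:R <= (n * q + n ^ 2 * e)%N%:R :> rat.
    by rewrite ler_nat class_second_moment.
  have qe : q%:R = D%:R * e%:R + 1 :> rat.
    by rewrite -natrM natr1 -FDe prednK // (leq_trans npos).
  have D1 : 1 <= D%:R :> rat by rewrite (ler_nat _ 1).
  have nq' : n%:R <= q%:R :> rat by rewrite ler_nat.
  have n0' : 0 <= n%:R :> rat by [].
  have D0' : 0 <= D%:R ^+ 2 :> rat by apply: sqr_ge0.
  have := ler_wpM2l D0' h.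
  rewrite !natrD !natrM.
  (* As [q = D * e + 1], the bound reduces to [D ^ 2 * n * q + D * n ^ 2], and the second term is at
     most the first. *)
  have a1 : n%:R * n%:R * D%:R <= D%:R ^+ 2 * (n%:R * q%:R) :> rat.
    rewrite mulrC; apply: ler_pM => //; first exact: mulr_ge0.
      by rewrite expr2 ler_peMl //; apply: le_trans D1.
    by rewrite ler_wpM2l.
  move: a1; rewrite qe; lra.
(* Only the class [w] is kept; a bad [c] has [D * f w c] below [n / 2], hence deviation at least
   [n ^ 2 / 4]. *)
have badle : #|Bad|%:R * (n%:R ^+ 2 / 4) <= 2 * D%:R ^+ 2 * n%:R * q%:R :> rat.
  apply: le_trans devle; rewrite (bigD1 w) //=.
  apply: ler_wpDr; first by do 2 (apply: sumr_ge0 => ? _); apply: sqr_ge0.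
  rewrite mulr_natl -sumr_const big_mkcond /=; apply: ler_sum => c _.
  case: ifP => [|_]; last exact: sqr_ge0.
  rewrite inE -(ltr_nat rat) !natrM => h; rewrite /dev.
  have : 0 <= n%:R - 2 * (D%:R * (f w c)%:R) :> rat by rewrite mulrA ltW // subr_gt0.
  have : 0 <= D%:R * (f w c)%:R :> rat by apply: mulr_ge0.
  have : 0 <= n%:R :> rat by [].
  move: (D%:R * _) (n%:R : rat) => a b b0 a0 ab.
  have : (b - a - b / 2) * (b - a + b / 2) >= 0 by apply: mulr_ge0; lra.
  by lra.
rewrite -(ler_nat rat) !natrM.
have npos' : 0 < n%:R :> rat by rewrite ltr0n.
rewrite -(ler_pM2r npos'); move: badle; rewrite expr2 /=; lra.
Qed.

End Variance.
End Cyclotomy.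

(** Greedy choice: all but boundedly many [c0] leave in every later [X j] a proportion at least
    [1 / (2 * D)] of points with the right class of difference to [c0]. The induction runs on these
    smaller sets, with [K] replaced by [2 * D * K]. *)
Lemma prescribed_differences (D t K : nat) : exists Q : nat,
  forall (F : finFieldType) (e : nat) (w : nat -> nat -> F) (X : nat -> {set F}),
    #|F|.-1 = (D * e)%N -> (Q <= #|F|)%N ->
    (forall i j, w i j \in uroots F D) ->
    (forall i, (i < t)%N -> (#|F| <= K * #|X i|)%N) ->
  exists c : nat -> F, (forall i, (i < t)%N -> c i \in X i) /\
    (forall i j, (i < j < t)%N -> c j - c i \in class e (w i j)).
Proof.
elim: t K => [|t IH] K.
  by exists 0%N => F e w X _ _ _ _; exists (fun=> 0); split=> // i j; rewrite ltn0 andbF.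
have [Q QP] := IH (2 * D * K)%N.
(* The second bound makes [X 0] larger than the union of the [t] bad sets. *)
exists (maxn Q (t * (8 * D ^ 2 * K) * K).+1) => F e w X FDe.
rewrite geq_max => /andP[QF tF] wU XK.
pose Bad (j : 'I_t) := [set c |
  (2 * D * #|[set y in X j.+1 | (y - c)%R \in class e (w 0%N j.+1)]| < #|X j.+1|)%N].
have q0 : (0 < #|F|)%N by apply: leq_trans tF.
have cBad j : (#|Bad j| <= 8 * D ^ 2 * K)%N.
  have := card_irregular FDe (X j.+1) (wU 0%N j.+1); rewrite -/(Bad j) => b.
  have := XK j.+1 (ltn_ord j) => x.
  rewrite -(leq_pmul2r q0); apply: leq_trans (_ : #|Bad j| * (K * #|X j.+1|) <= _)%N.
    by rewrite leq_mul2l x orbT.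
  by rewrite mulnCA [leqRHS]mulnAC [leqRHS]mulnC leq_mul2l b orbT.
have [c0 c0X c0good] : exists2 c0, c0 \in X 0%N & c0 \notin \bigcup_(j : 'I_t) Bad j.
  apply/subsetPn; apply/negP => /subset_leq_card.
  have := card_bigcup_le (fun (j : 'I_t) (_ : true) => cBad j).
  rewrite card_ord => b /leq_trans/(_ b) h.
  have := XK 0%N isT; rewrite leqNgt => /negP; apply.
  apply: leq_ltn_trans tF; rewrite mulnC leq_mul2r h orbT //.
pose X' i := [set y in X i.+1 | y - c0 \in class e (w 0%N i.+1)].
have X'K i : (i < t)%N -> (#|F| <= 2 * D * K * #|X' i|)%N.
  move=> it; apply: leq_trans (XK i.+1 it) _.
  rewrite mulnAC [leqRHS]mulnC leq_mul2l leqNgt; apply/orP; right.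
  apply: contraNN c0good => bad; apply/bigcupP; exists (Ordinal it) => //.
  by rewrite inE.
have [c [cX cw]] := QP F e (fun i j => w i.+1 j.+1) X' FDe QF (fun i j => wU _ _) X'K.
exists (fun i => if i is i'.+1 then c i' else c0); split.
  by case=> [|i] // it; have := cX i it; rewrite inE => /andP[].
case=> [|i] [|j] //= ij; last exact: cw.
by have := cX j ij; rewrite inE => /andP[].
Qed.

(** For a prime [p > D], Euler's theorem makes [D] divide [p ^ totient D - 1]. *)
Lemma large_field (D Q : nat) : (0 < D)%N ->
  exists (F : finFieldType) (e : nat), #|F|.-1 = (D * e)%N /\ (Q <= #|F|)%N.
Proof.
move=> D0; have [p pbig pp] := prime_above (maxn D Q).
have [pD pQ] : (D < p /\ Q < p)%N by move: pbig; rewrite gtn_max => /andP.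
have tD : (0 < totient D)%N by rewrite totient_gt0.
have [F _ cF] := PrimePowerField pp tD.
have coDp : coprime p D.
  rewrite prime_coprime //; apply/negP => /(dvdn_leq D0); lia.
have := Euler_exp_totient coDp; rewrite -cF => /eqP.
have F1 := card_finRing_gt1 F.
rewrite eqn_mod_dvd ?(ltnW F1) // subn1 => /dvdnP[e E].
exists F, e; split; first by rewrite E mulnC.
by rewrite cF; apply: leq_trans (ltnW pQ) _; rewrite -[leqLHS]expn1 leq_exp2l // prime_gt1.
Qed.

(** * Transversal packings *)

Lemma card_sets_containing (T : finType) (r : nat) (i j : T) : i != j ->
  (#|[set S : {set T} | [&& #|S| == r, i \in S & j \in S]]| <= 'C(#|T|.-2, r.-2))%N.
Proof.
move=> ij; set A := [set S | _].
have rest_inj : {in A &, injective (fun S : {set T} => S :\: [set i; j])}.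
  move=> S S'; rewrite !inE => /and3P[_ iS jS] /and3P[_ iS' jS'] E.
  have sub (U : {set T}) : i \in U -> j \in U -> U = [set i; j] :|: (U :\: [set i; j]).
    move=> iU jU; rewrite setDE setUIr setUCr setIT; apply/esym/setUidPr.
    by apply/subsetP => z /set2P[]->.
  by rewrite (sub S) // (sub S') // E.
rewrite -(card_in_imset rest_inj).
have cij : #|[set i; j]| = 2 by rewrite cards2 ij.
have -> : #|T|.-2 = #|~: [set i; j]| by have := cardsC [set i; j]; rewrite cij; lia.
rewrite -cards_draws; apply: subset_leq_card; apply/subsetP => _ /imsetP[S SA ->].
move: SA; rewrite !inE => /and3P[/eqP rS iS jS]; rewrite setDE subsetIr /=.
rewrite -setDE cardsD (setIidPr _) ?cij ?rS; first by apply/eqP; lia.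
by apply/subsetP => z /set2P[]->.
Qed.

(** At most [D] sets of size [r] contain both [i] and [j], so they can be given distinct elements of
    [uroots], which [prescribed_differences] realizes as classes of the differences. *)
Lemma separating_slopes (k r : nat) : exists Q : nat,
  forall (F : finFieldType) (e : nat), #|F|.-1 = ('C(k.-2, r.-2) * e)%N -> (Q <= #|F|)%N ->
  exists c : {set 'I_k} -> 'I_k -> F, forall (S S' : {set 'I_k}) (i j : 'I_k),
    (i < j)%N -> #|S| = r -> #|S'| = r -> i \in S -> j \in S -> i \in S' -> j \in S' ->
    c S i != c S j /\ ((c S j - c S i) ^+ e = (c S' j - c S' i) ^+ e -> S = S').
Proof.
set D := 'C(_, _); have [Q QP] := prescribed_differences D k 1.
exists Q => F e FDe QF.
pose A i j := [set S : {set 'I_k} |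
  [&& #|S| == r, i \in [seq val a | a <- enum S] & j \in [seq val a | a <- enum S]]].
have AE (i j : 'I_k) S : (S \in A i j) = [&& #|S| == r, i \in S & j \in S].
  by rewrite inE !(mem_map val_inj) !mem_enum.
(* The default 1 lies in [uroots], so [w] names a class for all arguments. *)
pose w (S : {set 'I_k}) i j : F := nth 1 (enum (uroots F D)) (index S (enum (A i j))).
have wU S i j : w S i j \in uroots F D.
  rewrite /w; case: (ltnP (index S (enum (A i j))) (size (enum (uroots F D)))) => h.
    by rewrite -mem_enum mem_nth.
  by rewrite nth_default // inE expr1n.
have /fin_all_exists[c cP] (S : {set 'I_k}) : exists c : nat -> F,
    forall i j, (i < j < k)%N -> c j - c i \in class e (w S i j).
  have XT i : (i < k)%N -> (#|F| <= 1 * #|[set: F]|)%N by rewrite cardsT mul1n.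
  have [c [_ cP]] := QP F e (w S) (fun=> setT) FDe QF (wU S) XT.
  by exists c.
exists (fun S i => c S i) => S S' i j ij rS rS' iS jS iS' jS'.
have ijk : (i < j < k)%N by rewrite ij ltn_ord.
have := cP S i j ijk; have := cP S' i j ijk => cS' cS; split.
  by have := mem_class_neq0 FDe (wU S i j) cS; rewrite subr_eq0 eq_sym.
move: cS cS'; rewrite !inE => /eqP -> /eqP -> /eqP.
have SA : S \in A i j by rewrite AE rS eqxx iS.
have S'A : S' \in A i j by rewrite AE rS' eqxx iS'.
have lt S0 : S0 \in A i j -> (index S0 (enum (A i j)) < size (enum (uroots F D)))%N.
  move=> S0A; rewrite -cardE (card_uroots FDe).
  apply: (@leq_trans #|A i j|); first by rewrite cardE index_mem mem_enum.
  have ij' : i != j by rewrite -(inj_eq val_inj) neq_ltn ij.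
  have := card_sets_containing r ij'; rewrite card_ord; apply: leq_trans.
  by apply: subset_leq_card; apply/subsetP => U; rewrite AE inE.
rewrite nth_uniq ?enum_uniq ?lt // => /eqP; apply: (index_inj S); rewrite mem_enum //.
Qed.

(** * The blocks and their linearity *)

Section Blocks.
Variables (k r M e : nat) (F : finFieldType) (c : {set 'I_k} -> 'I_k -> F).
Hypotheses (M1 : (1 < M)%N) (coM : coprime M k`!).
Hypothesis cP : forall (S S' : {set 'I_k}) (i j : 'I_k),
  (i < j)%N -> #|S| = r -> #|S'| = r -> i \in S -> j \in S -> i \in S' -> j \in S' ->
  c S i != c S j /\ ((c S j - c S i) ^+ e = (c S' j - c S' i) ^+ e -> S = S').

Definition block_vertex : finType := ('I_k * F * 'Z_M)%type.
Definition block_param : finType := ({set 'I_k} * (F * F) * ('Z_M * 'Z_M))%type.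

Definition block_point (p : block_param) (i : 'I_k) : block_vertex :=
  let: (A, (a, b), (x, y)) := p in (i, a + b * c A i, x + y *+ i).

Definition block (p : block_param) : {set block_vertex} := block_point p @: p.1.1.

Definition block_dom : {set block_param} :=
  setX (setX [set S : {set 'I_k} | #|S| == r] (setX setT [set b | b ^+ e == 1])) setT.

Lemma block_point_fst p i : (block_point p i).1.1 = i.
Proof. by case: p => [[S [a b]] [x y]]. Qed.

Lemma block_point_inj p : injective (block_point p).
Proof. by move=> i j /(congr1 (fun z : block_vertex => z.1.1)); rewrite !block_point_fst. Qed.

Lemma block_col_inj p : {in block p &, injective (fun z : block_vertex => z.1.1)}.
Proof. by move=> _ _ /imsetP[i _ ->] /imsetP[j _ ->]; rewrite !block_point_fst => ->. Qed.

(** The difference [j - i] divides [k!], hence is a unit modulo [M]. *)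
Lemma mul_sub_ord_inj (i j : 'I_k) (y y' : 'Z_M) : (i < j)%N ->
  y *+ j - y *+ i = y' *+ j - y' *+ i -> y = y'.
Proof.
move=> ij; rewrite -!mulrnBr ?(ltnW ij) // -[LHS]mulr_natr -[RHS]mulr_natr.
apply: mulIr; rewrite unitZpE //; apply: coprime_dvdr coM.
by apply: dvdn_fact; have := ltn_ord j; lia.
Qed.

(** Two columns determine the block: since [b ^+ e = 1], the [e]-th power of the difference of field
    coordinates identifies [S]; then [b] and [a] follow in the field, and [y] and [x] modulo [M]. *)
Lemma block_unique p p' z z' : p \in block_dom -> p' \in block_dom -> z != z' ->
  z \in block p -> z' \in block p -> z \in block p' -> z' \in block p' -> p = p'.
Proof.
move=> pD p'D neq /imsetP[i iS zE] /imsetP[j jS z'E].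
rewrite {z}zE {z'}z'E in neq *; move=> /imsetP[i' iS' Ei] /imsetP[j' jS' Ej].
have {neq} ij : i != j by apply: contraNneq neq => ->.
have ii' : i = i' by have := congr1 (fun z : block_vertex => z.1.1) Ei; rewrite !block_point_fst.
have jj' : j = j' by have := congr1 (fun z : block_vertex => z.1.1) Ej; rewrite !block_point_fst.
subst i' j'; wlog lt_ij : i j ij iS jS iS' jS' Ei Ej / (i < j)%N.
  move=> IH; case: (ltngtP i j) => h; first exact: (IH i j).
    by apply: (IH j i); rewrite // eq_sym.
  by case/eqP: ij; apply: val_inj.
move: p p' pD p'D iS jS iS' jS' Ei Ej => [[S [a b]] [x y]] [[S' [a' b']] [x' y']].
rewrite !inE /= !andbT => /andP[/eqP rS /eqP be] /andP[/eqP rS' /eqP b'e] iS jS iS' jS' Ei Ej.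
have E1 : a + b * c S i = a' + b' * c S' i :=
  congr1 (fun z : block_vertex => z.1.2) Ei.
have E2 : x + y *+ i = x' + y' *+ i := congr1 (fun z : block_vertex => z.2) Ei.
have E3 : a + b * c S j = a' + b' * c S' j :=
  congr1 (fun z : block_vertex => z.1.2) Ej.
have E4 : x + y *+ j = x' + y' *+ j := congr1 (fun z : block_vertex => z.2) Ej.
have [cij cSS'] := cP lt_ij rS rS' iS jS iS' jS'.
have Eb : b * (c S j - c S i) = b' * (c S' j - c S' i).
  have : (a + b * c S j) - (a + b * c S i) = (a' + b' * c S' j) - (a' + b' * c S' i).
    by rewrite E1 E3.
  by move=> h; apply: etrans (etrans h _); ring.
have SS' : S = S'.
  by apply: cSS'; have := congr1 (fun z => z ^+ e) Eb; rewrite !exprMn be b'e !mul1r.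
subst S'; move: Eb => /mulIf; rewrite subr_eq0 eq_sym => /(_ cij) bb'.
subst b'; move: E1 => /addIr aa'; subst a'.
have yy' : y = y'.
  apply: (mul_sub_ord_inj lt_ij).
  have : (x + y *+ j) - (x + y *+ i) = (x' + y' *+ j) - (x' + y' *+ i) by rewrite E2 E4.
  by move=> h; apply: etrans (etrans h _); rewrite opprD addrACA subrr add0r.
by subst y'; move: E2 => /addIr ->.
Qed.

Lemma card_block p : p \in block_dom -> #|block p| = r.
Proof.
move=> pD; rewrite card_imset; last exact: block_point_inj.
by move: pD; rewrite !inE => /andP[/andP[/eqP]].
Qed.

Lemma block_hypergraph n : (2 <= r)%N -> (0 < k)%N -> (k * #|F| * M <= n)%N ->
  exists (H : {set {set 'I_n}}) (col : 'I_n -> 'I_k),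
    [/\ uniform r H, Defs.linear H, forall E, E \in H -> {in E &, injective col} &
        #|H| = #|block_dom|].
Proof.
move=> r2 k0 Mn.
have cV : (#|block_vertex| <= n)%N.
  by rewrite !card_prod !card_ord Zp_cast.
pose io (z : block_vertex) : 'I_n := widen_ord cV (enum_rank z).
have io_inj : injective io by move=> z z' /(congr1 val) /= /val_inj /enum_rank_inj.
(* Vertices outside the image of [io] lie in no hyperedge and get an arbitrary colour. *)
pose col (v : 'I_n) : 'I_k := if [pick z | io z == v] is Some z then z.1.1 else Ordinal k0.
have colE z : col (io z) = z.1.1.
  by rewrite /col; case: pickP => [z' /eqP/io_inj->//|/(_ z)]; rewrite eqxx.
have same p p' : p \in block_dom -> p' \in block_dom ->
    (1 < #|io @: block p :&: io @: block p'|)%N -> p = p'.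
  move=> pD p'D /card_gt1P[u [v [+ + uv]]].
  move=> /setIP[/imsetP[z zp E] /imsetP[z2 z2p' E2]].
  move=> /setIP[/imsetP[t tp E3] /imsetP[t2 t2p' E4]].
  have zz : z2 = z by apply: io_inj; rewrite -E -E2.
  have tt : t2 = t by apply: io_inj; rewrite -E3 -E4.
  rewrite zz in z2p'; rewrite tt in t2p'.
  apply: (@block_unique p p' z t) => //.
  by apply: contraNneq uv => zt; rewrite E E3 zt.
exists [set io @: block p | p in block_dom], col; split.
- by apply/forall_inP => _ /imsetP[p pD ->]; rewrite card_imset // card_block.
- apply/forall_inP => _ /imsetP[p pD ->]; apply/forall_inP => _ /imsetP[p' p'D ->].
  apply/implyP; apply: contraNleq => /(same _ _ pD p'D) -> //.
- move=> _ /imsetP[p pD ->] _ _ /imsetP[z zp ->] /imsetP[t tp ->].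
  by rewrite !colE => /(block_col_inj zp tp) ->.
- rewrite card_in_imset // => p p' pD p'D E; apply: same => //.
  by rewrite -E setIid card_imset // card_block.
Qed.

Lemma card_block_dom :
  #|block_dom| = ('C(k, r) * (#|F| * #|[set b : F | (b ^+ e == 1)%R]|) * M ^ 2)%N.
Proof.
by rewrite /block_dom !cardsX !cardsT card_draws card_ord card_prod card_ord Zp_cast //.
Qed.

End Blocks.

(* An asymptotically complete linear system of r-sets transversal to [k] classes
   of size [q * M], for a fixed large prime power [q] and any [M] prime to [k!]. *)
Lemma partite_packing (k r q0 : nat) : (2 <= r)%N -> (r <= k)%N ->
  exists2 q : nat, (q0 <= q)%N & forall M n, (1 < M)%N -> coprime M k`! ->
    (k * q * M <= n)%N ->
  exists (H : {set {set 'I_n}}) (col : 'I_n -> 'I_k),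
    [/\ uniform r H, Defs.linear H, forall E, E \in H -> {in E &, injective col} &
        (r * r.-1 * #|H| = k * k.-1 * (q * q.-1 * M ^ 2))%N].
Proof.
move=> r2 rk; have [Q QP] := separating_slopes k r.
have D0 : (0 < 'C(k.-2, r.-2))%N by rewrite bin_gt0; lia.
have [F [e [FDe QF]]] := large_field (maxn Q q0) D0.
move: QF; rewrite geq_max => /andP[QF qF].
exists #|F| => // M n M1 coM Mn.
have [c cP] := QP F e FDe QF.
have k0 : (0 < k)%N by lia.
have [H [col [H1 H2 H3 H4]]] := block_hypergraph M1 coM cP r2 k0 Mn.
exists H, col; split=> //; rewrite H4 card_block_dom //.
have -> : #|[set b : F | b ^+ e == 1]| = e.
  by apply: (card_class FDe); rewrite inE expr1n.
(* Both sides count [r]-subsets with an ordered pair of distinct elements. *)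
have binE : (r * r.-1 * 'C(k, r) = k * k.-1 * 'C(k.-2, r.-2))%N.
  have [r' rE] : exists r', r = r'.+2 by exists r.-2; lia.
  have h1 := mul_bin_diag k r'.+1; have h2 := mul_bin_diag k.-1 r'.
  by rewrite rE /= mulnAC -h1 -mulnA [(_ * r'.+1)%N]mulnC -h2 mulnA.
rewrite FDe !mulnA binE; ring.
Qed.

(** In a copy of [F^r], adjacent vertices of [F] share a hyperedge, so [col] would pull back to a
    proper [k]-colouring of [F]. *)
Lemma expansion_free_of_coloring (V : finType) (adj : rel V) k r n
    (H : {set {set 'I_n}}) (col : 'I_n -> 'I_k) :
  irreflexive adj -> ~~ colorable adj k ->
  (forall E, E \in H -> {in E &, injective col}) -> ~ contains_copy (expansion adj r) H.
Proof.
move=> irr /negP ncol inj_col [f [f_inj fH]]; apply: ncol.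
apply/existsP; exists [ffun v => col (f (inl v))].
apply/forallP => u; apply/forallP => v; apply/implyP => uv; rewrite !ffunE.
pose e := [set u; v].
have eF : e \in graph_edges adj.
  by rewrite inE; apply/existsP; exists u; apply/existsP; exists v; rewrite eqxx.
pose E := [set (inl x : exp_vertex V r) | x in e] :|: [set inr (e, i) | i : 'I_(r - 2)].
have EH : f @: E \in H by apply: fH; apply/imsetP; exists e.
have inE' z : z \in e -> f (inl z) \in f @: E.
  by move=> ze; rewrite imset_f // inE imset_f.
apply/negP => /eqP/(inj_col _ EH); rewrite !inE' ?inE ?eqxx ?orbT //.
move=> /(_ isT isT)/f_inj [E1]; move: uv; by rewrite E1 irr.
Qed.

(** * Asymptotics *)

Section Form.
Variables (R : realType) (n r : nat) (H : {set {set 'I_n}}).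

Definition qform (x : 'I_n -> R) : R :=
  \sum_(v < n) (degree H v)%:R * x v ^+ r + r%:R * \sum_(e in H) \prod_(v in e) x v.

Lemma root_exists (y : R) : 0 <= y -> (0 < r)%N -> exists2 a : R, 0 <= a & a ^+ r = y.
Proof.
move=> y0 r0; have y1 : 0 <= 1 + y by rewrite addr_ge0.
have [] := @poly_ivt R ('X^r - y%:P) 0 (1 + y) y1.
  rewrite !hornerE expr0n gtn_eqF // sub0r oppr_le0 y0 subr_ge0 /=.
  apply: (@le_trans _ _ (1 + y)); first by rewrite lerDr.
  by rewrite ler_eXnr ?lerDl.
by move=> a /andP[a0 _]; rewrite /root !hornerE subr_eq0 => /eqP; exists a.
Qed.

Lemma qform_const (a : R) : uniform r H ->
  qform (fun=> a) = 2 * r%:R * #|H|%:R * a ^+ r.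
Proof.
move=> uni; rewrite /qform -mulr_suml.
have -> : \sum_(v < n) (degree H v)%:R = r%:R * #|H|%:R :> R.
  rewrite -natr_sum -natrM; congr (_%:R).
  have -> : (r * #|H| = \sum_(e in H) #|e|)%N.
    rewrite mulnC -sum_nat_const; apply: eq_bigr => e eH.
    by rewrite (card_edge uni eH).
  rewrite /degree; under [RHS]eq_bigr => e _ do rewrite -sum1_card.
  rewrite (exchange_big_dep xpredT) //=; apply: eq_bigr => v _.
  by rewrite -sum1_card; apply: eq_bigl => e; rewrite inE.
rewrite (eq_bigr (fun=> a ^+ r)) => [|e eH]; last first.
  by rewrite prodr_const (card_edge uni eH).
by rewrite sumr_const -[a ^+ r *+ _]mulr_natl; ring.
Qed.

End Form.

Lemma qform_bound (R : realType) (V : finType) (adj : rel V) k r (eps : R) :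
    irreflexive adj -> colorable adj k.+1 -> (2 <= k)%N -> (2 <= r)%N -> 0 < eps ->
  exists2 N : nat, (0 < N)%N & forall n (H : {set {set 'I_n}}), (N <= n)%N ->
    Defs.linear H -> uniform r H -> ~ contains_copy (expansion adj r) H ->
    forall x : 'I_n -> R, \sum_(v < n) `|x v| ^+ r = 1 ->
    qform r H x <= (2 * n%:R / (r%:R - 1)) * (1 - k%:R^-1) + eps * n%:R.
Proof.
move=> irr col k2 r2 e0.
have rr : 0 < r%:R - 1 :> R by rewrite subr_gt0 ltr1n.
(* The error [2 * eps' * n / (r - 1)] left after division by [2 * (r - 1)] must equal [eps * n]. *)
have e0' : 0 < eps * (r%:R - 1) / 2 by rewrite divr_gt0 // mulr_gt0.
have [N NP] := shadow_bound irr col k2 r2 e0'.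
exists (maxn 1 N) => [|n H]; first by rewrite leq_max.
rewrite geq_max => /andP[n1 nN] lin uni nocopy x x1.
have n0 : 0 < n%:R :> R by rewrite ltr0n.
pose y v := Num.sqrt (`|x v| ^+ r).
have y0 v : 0 <= y v by apply: sqrtr_ge0.
have yx v : y v ^+ 2 = `|x v| ^+ r by rewrite sqr_sqrtr // exprn_ge0.
pose t : R := Num.sqrt n%:R.
have tt : t ^+ 2 = n%:R by rewrite sqr_sqrtr // ltW.
have Y0 v : 0 <= t * y v by rewrite mulr_ge0 // sqrtr_ge0.
have YQ : \sum_u (t * y u) ^+ 2 = n%:R.
  under eq_bigr => u _ do rewrite exprMn tt yx.
  by rewrite -mulr_sumr x1 mulr1.
have := NP n H nN lin uni nocopy _ Y0 YQ.
have -> : \sum_u \sum_(v | shadow H u v) (t * y u + t * y v) ^+ 2 =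
    n%:R * \sum_u \sum_(v | shadow H u v) (y u + y v) ^+ 2.
  rewrite mulr_sumr; apply: eq_bigr => u _; rewrite mulr_sumr.
  by apply: eq_bigr => v _; rewrite -mulrDr exprMn tt.
rewrite expr2 [leRHS]mulrCA ler_pM2l // => Sle.
apply: le_trans (form_le_shadow lin uni r2 y0 yx) _.
rewrite ler_pdivrMr; last by rewrite mulr_gt0.
apply: le_trans Sle _; rewrite le_eqVlt; apply/orP; left; apply/eqP.
have kn0 : k%:R != 0 :> R by rewrite pnatr_eq0 -lt0n (leq_trans _ k2).
have rn0 : r%:R - 1 != 0 :> R by rewrite gt_eqF.
by field; rewrite ?kn0 ?rn0.
Qed.

(** Taking [M] congruent to 1 modulo [k!] secures coprimality and leaves a number of vertices
    bounded in terms of [k] and [q]. *)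
Lemma choose_modulus k q n : (0 < k)%N -> (0 < q)%N -> (k * q * (k`! + 2) <= n)%N ->
  exists2 M, [/\ (1 < M)%N, coprime M k`! & (k * q * M <= n)%N] &
    (n <= k * q * M + k * q * (k`! + 2))%N.
Proof.
move=> k0 q0 nbig; have kq0 : (0 < k * q)%N by rewrite muln_gt0 k0.
have f0 := fact_gt0 k.
pose t := (n %/ (k * q))%N.
have tbig : (k`! + 2 <= t)%N by rewrite leq_divRL // mulnC.
have tn : (k * q * t <= n)%N by rewrite mulnC leq_trunc_div.
have nt : (n < k * q * t.+1)%N by rewrite mulnC ltn_ceil.
pose s := (t.-1 %/ k`!)%N.
have s1 : (0 < s)%N by rewrite divn_gt0 //; lia.
have st : (s * k`! <= t.-1)%N by apply: leq_trunc_div.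
have ts : (t.-1 < s.+1 * k`!)%N by apply: ltn_ceil.
exists (s * k`! + 1)%N; first split.
- by have : (1 * 1 <= s * k`!)%N := leq_mul s1 f0; lia.
- by rewrite coprime_sym /coprime gcdnMDl gcdn1.
- by apply: leq_trans tn; rewrite leq_mul2l; apply/orP; right; lia.
- rewrite -mulnDr; apply: leq_trans (ltnW nt) _; rewrite leq_mul2l; apply/orP; right.
  by move: ts; rewrite mulSn; lia.
Qed.

(** Here [N] counts the vertices used, [C] bounds the rest, and [qi = 1 / q] is the share of
    transversal pairs with equal field coordinates, which no block covers. *)
Lemma density_loss (R : realFieldType) (lam qi C n N eps : R) :
    0 <= lam <= 2 -> 0 <= qi <= eps / 4 -> 0 <= C -> 8 * C <= eps * n -> 0 < n -> C <= n ->
    n <= N + C -> eps <= 1 ->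
  lam * n - eps * n <= lam * (1 - qi) * N ^+ 2 / n.
Proof.
move=> /andP[l0 l2] /andP[q0 qe] C0 Cn n0 Cn' nN e1.
rewrite ler_pdivlMr //.
have h1 : n * (n - 2 * C) <= N ^+ 2.
  apply: (@le_trans _ _ ((n - C) ^+ 2)).
    have -> : (n - C) ^+ 2 = n * (n - 2 * C) + C ^+ 2 by ring.
    by rewrite lerDl sqr_ge0.
  by rewrite ler_sqr ?nnegrE; lra.
have q1 : 0 <= 1 - qi by lra.
have lq0 : 0 <= lam * (1 - qi) by apply: mulr_ge0.
apply: le_trans (ler_wpM2l lq0 h1).
have -> : lam * (1 - qi) * (n * (n - 2 * C)) = lam * (1 - qi) * (n - 2 * C) * n by ring.
rewrite ler_pM2r //.
have : lam * qi * n <= 2 * (eps / 4) * n.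
  by rewrite ler_pM2r //; apply: ler_pM.
have : lam * (1 - qi) * C <= 2 * C.
  by apply: ler_wpM2r => //; apply: le_trans (ler_wpM2r q1 l2) _; lra.
lra.
Qed.

Lemma packing_value (R : realType) (k r : nat) (eps : R) : (2 <= r)%N -> (r <= k)%N -> 0 < eps ->
  exists N : nat, forall n, (N <= n)%N ->
  exists (H : {set {set 'I_n}}) (col : 'I_n -> 'I_k),
    [/\ uniform r H, Defs.linear H, forall E, E \in H -> {in E &, injective col} &
        (2 * n%:R / (r%:R - 1)) * (1 - k%:R^-1) - eps * n%:R <= 2 * r%:R * #|H|%:R / n%:R].
Proof.
(* A smaller [eps] gives a stronger claim, and [density_loss] is stated for [eps <= 1]. *)
move=> r2 rk; wlog e1 : eps / eps <= 1.
  move=> IH e0; have m0 : 0 < Num.min eps 1 by rewrite lt_min e0 ltr01.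
  have m1 : Num.min eps 1 <= 1 by rewrite ge_min lexx orbT.
  have [N NP] := IH _ m1 m0; exists N => n nN.
  have [H [col [h1 h2 h3 h4]]] := NP n nN; exists H, col; split=> //.
  by apply: le_trans h4; rewrite lerB // ler_wpM2r // ge_min lexx.
(* This makes [1 / q] at most [eps / 4]. *)
move=> e0; pose q0 := (Num.bound (4 / eps)).+1.
have [q qq0 qP] := partite_packing q0 r2 rk.
have q1 : (0 < q)%N by apply: leq_trans qq0.
have k0 : (0 < k)%N by lia.
have qinv : 0 <= (q%:R^-1 : R) <= eps / 4.
  rewrite invr_ge0 ler0n /= -[leRHS]invrK lef_pV2 ?posrE ?ltr0n ?invr_gt0 ?divr_gt0 //.
  rewrite invf_div; apply: (@le_trans _ _ q0%:R); last by rewrite ler_nat.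
  apply: ltW; apply: lt_le_trans (archi_boundP _) _; first by rewrite divr_ge0 ?ltW.
  by rewrite ler_nat.
pose C := (k * q * (k`! + 2))%N.
exists (maxn 1 (maxn C (Num.bound (8 * C%:R / eps)))) => n.
rewrite !geq_max => /and3P[n1 nC nb].
have [M [M1 coM Mn] nM] := choose_modulus k0 q1 nC.
have [H [col [h1 h2 h3 h4]]] := qP M n M1 coM Mn.
exists H, col; split=> //.
have n0 : 0 < n%:R :> R by rewrite ltr0n.
have rr : 0 < r%:R - 1 :> R by rewrite subr_gt0 ltr1n.
pose lam : R := 2 / (r%:R - 1) * (1 - k%:R^-1).
have kr0 : 0 < k%:R :> R by rewrite ltr0n.
have qr0 : 0 < q%:R :> R by rewrite ltr0n.
have lam02 : 0 <= lam <= 2.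
  have k1 : 0 <= 1 - (k%:R^-1 : R) <= 1.
    rewrite subr_ge0 invf_le1 // ler1n k0 /= lerBlDr lerDl.
    by rewrite invr_ge0 ltW.
  have /andP[k1a k1b] := k1.
  have r1 : 0 <= 2 / (r%:R - 1 : R) <= 2.
    rewrite divr_ge0 ?(ltW rr) //= ler_pdivrMr // ler_peMr //.
    by rewrite lerBrDr (ler_nat _ 2).
  have /andP[r1a r1b] := r1.
  rewrite mulr_ge0 //= -[leRHS]mulr1; exact: ler_pM.
have Ce : 8 * C%:R <= eps * n%:R.
  rewrite [leRHS]mulrC -ler_pdivrMr //; apply: ltW.
  apply: lt_le_trans (archi_boundP _) _; last by rewrite ler_nat.
  by rewrite divr_ge0 ?mulr_ge0 // ltW.
have nN : n%:R <= (k * q * M)%N%:R + C%:R :> R by rewrite -natrD ler_nat.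
have nC' : C%:R <= n%:R :> R by rewrite ler_nat.
have := density_loss lam02 qinv (ler0n _ _) Ce n0 nC' nN e1.
have -> : 2 * n%:R / (r%:R - 1) * (1 - k%:R^-1) = lam * n%:R by rewrite /lam; ring.
move/le_trans; apply; rewrite le_eqVlt; apply/orP; left; apply/eqP.
congr (_ / _).
have := congr1 (fun m => m%:R : R) h4; rewrite !natrM.
have pred1 m : (0 < m)%N -> m.-1%:R = m%:R - 1 :> R.
  by move=> m0; rewrite -subn1 natrB.
rewrite (pred1 r) ?(pred1 k) ?(pred1 q) //; last exact: leq_trans r2.
move=> E; apply: (mulfI (_ : r%:R - 1 != 0 :> R)); first by rewrite gt_eqF.
transitivity (2 * (r%:R * (r%:R - 1) * #|H|%:R) : R); last by ring.
have kn0 : k%:R != 0 :> R by rewrite gt_eqF.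
have qn0 : q%:R != 0 :> R by rewrite gt_eqF.
have rn0 : r%:R - 1 != 0 :> R by rewrite gt_eqF.
by rewrite E /lam; field; rewrite ?kn0 ?qn0 ?rn0.
Qed.

Lemma chromatic_numberP (V : finType) (adj : rel V) (irr : irreflexive adj) k :
  chromatic_number irr = k.+1 -> colorable adj k.+1 /\ ~~ colorable adj k.
Proof.
rewrite /chromatic_number; case: ex_minnP => m mcol mmin mk; rewrite -mk; split=> //.
by apply/negP => /mmin; rewrite mk ltnn.
Qed.

Unset Implicit Arguments.

Theorem theorem2p17 (R : realType) (V : finType) (adj : rel V)
  (Hsym : symmetric adj) (Hirr : irreflexive adj) (k r : nat)
  (Hr : (2 <= r)%N) (Hkr : (r <= k)%N)
  (Hchi : chromatic_number Hirr = k.+1) :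
  forall eps : R, 0 < eps -> exists N : nat, forall n : nat, (N <= n)%N ->
    `| ex_lin_q n R adj r
       - (2 * n%:R / (r%:R - 1)) * (1 - k%:R^-1) | <= eps * n%:R.
Proof.
move=> eps e0; have k2 := leq_trans Hr Hkr.
have [colk1 ncolk] := chromatic_numberP Hchi.
have [N1 N1_gt0 upper] := qform_bound Hirr colk1 k2 Hr e0.
have [N2 lower] := packing_value Hr Hkr e0.
exists (maxn N1 N2) => n; rewrite geq_max => /andP[nN1 nN2].
set L := 2 * n%:R / _ * _.
have n0 : 0 < n%:R :> R by rewrite ltr0n (leq_trans N1_gt0).
have r0 : (0 < r)%N by apply: leq_trans Hr.
(* The constant vector with entries [n ^ (-1/r)] has unit norm; it serves as the test vector for the
   lower bound. *)
have [a a0 ar] : exists2 a : R, 0 <= a & a ^+ r = n%:R^-1.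
  by apply: root_exists; rewrite ?invr_ge0 ?ltW.
have a1 : \sum_(v < n) `|a| ^+ r = 1.
  by rewrite sumr_const card_ord ger0_norm // ar -[LHS]mulr_natl divff ?gt_eqF.
(* A supremum needs a nonempty bounded set: the constant vector gives a member, and [upper] the
   bound. *)
have q_le (H : {set {set 'I_n}}) : uniform r H -> Defs.linear H ->
    ~ contains_copy (expansion adj r) H ->
    qform r H (fun=> a) <= q_spec R r H <= L + eps * n%:R.
  move=> uni lin nocopy.
  have ub : classical_sets.ubound (fun y : R => exists x : 'I_n -> R,
      \sum_(v < n) `|x v| ^+ r = 1 /\ y = qform r H x) (L + eps * n%:R).
    by move=> _ [x [x1 ->]]; apply: upper.
  apply/andP; split.
    by apply: ub_le_sup; [exists (L + eps * n%:R) | exists (fun=> a)].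
  by apply: ge_sup ub; exists (qform r H (fun=> a)), (fun=> a).
have ub : classical_sets.ubound (fun y : R => exists H : {set {set 'I_n}},
    [/\ uniform r H, Defs.linear H, ~ contains_copy (expansion adj r) H &
        y = q_spec R r H]) (L + eps * n%:R).
  by move=> _ [H [uni lin nocopy ->]]; have /andP[] := q_le H uni lin nocopy.
have [H [col [uni lin inj_col Hbig]]] := lower n nN2.
have nocopy := expansion_free_of_coloring Hirr ncolk inj_col.
rewrite ler_norml; apply/andP; split; last first.
  by rewrite lerBlDl; apply: ge_sup ub; exists (q_spec R r H), H.
rewrite lerBrDr addrC.
have /andP[qH _] := q_le H uni lin (nocopy r).
apply: (@le_trans _ _ (q_spec R r H)).
  by apply: le_trans qH; rewrite qform_const // ar.
by apply: ub_le_sup; [exists (L + eps * n%:R) | exists H].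
Qed.
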